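(* Let $B$ be a finite left regular band monoid and $\Bbbk$ a commutative ring with unit. Then $\mathrm{cd}_\Bbbk B$ is the largest $n$ such that $\tilde H^{n-1}(\Delta(\partial e_YB);\Bbbk)\ne0$ for some $Y\in\Lambda(B)$, where $e_Y\in B$ satisfies $Be_Y=Y$.
   Context: A left regular band monoid is a finite monoid $B$ with $x^2=x$, $xyx=xy$, ordered by $a\le b$ iff $ba=a$; $\Lambda(B)=\{Bb\mid b\in B\}$; $\Delta(\cdot)$ is the order complex (simplicial complex of chains); $\partial aB=aB\setminus\{a\}$. Reduced cohomology convention: $\tilde H^{-1}(\emptyset;\Bbbk)=\Bbbk$ and $\tilde H^{-1}(Z;\Bbbk)=0$ for $Z\ne\emptyset$. For a $\Bbbk B$-module $V$, $H^n(B,V)=\mathrm{Ext}^n_{\Bbbk B}(\Bbbk,V)$ with $\Bbbk$ the trivial module, and $\mathrm{cd}_\Bbbk B=\sup\{n\mid H^n(B,V)\ne0\text{ for some }\Bbbk B\text{-module }V\}$. *)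

(* Defs.v *)
From HB Require Import structures.
From mathcomp Require Import all_boot all_order all_algebra.

Set Implicit Arguments.
Unset Strict Implicit.
Unset Printing Implicit Defensive.

Import Order.TTheory GRing.Theory.

Local Open Scope ring_scope.

#[short(type="finMonoidType")]
HB.structure Definition FinMonoid := {B of Finite B & Monoid B}.

HB.mixin Record isLeftRegularBand B of Monoid B := {
  lrb_idem : forall x : B, (x * x = x)%g;
  lrb_regular : forall x y : B, (x * y * x = x * y)%g
}.

#[short(type="finLRBType")]
HB.structure Definition FinLRB := {B of FinMonoid B & isLeftRegularBand B}.

Fact lrb_display : Order.disp_t. Proof. exact: Order.Disp tt tt. Qed.

Section LRBOrder.
Variable B : finLRBType.
Implicit Types a b c : B.

Definition lrb_le a b : bool := (b * a == a)%g.

Lemma lrb_le_refl : reflexive lrb_le.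
Proof. by move=> a; rewrite /lrb_le lrb_idem. Qed.

Lemma lrb_le_anti : antisymmetric lrb_le.
Proof.
move=> a b /andP[/eqP hab /eqP hba].
by rewrite -hab -{1}hba lrb_regular hba.
Qed.

Lemma lrb_le_trans : transitive lrb_le.
Proof. by move=> b a c /eqP <- /eqP hbc; rewrite /lrb_le mulgA hbc. Qed.

Definition lrb_poset : Type := B.

HB.instance Definition _ := Finite.copy lrb_poset B.
HB.instance Definition _ := Order.Le_isPOrder.Build lrb_display lrb_poset
  lrb_le_refl lrb_le_anti lrb_le_trans.

Definition left_ideal b : {set B} := [set (x * b)%g | x : B].
Definition right_ideal b : {set B} := [set (b * x)%g | x : B].
Definition Lambda : {set {set B}} := [set left_ideal b | b : B].
Definition boundary b : {set lrb_poset} := right_ideal b :\ b.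

End LRBOrder.
Arguments Lambda B : clear implicits.

Section OrderComplex.
Variables (d : Order.disp_t) (T : finPOrderType d) (A : {set T}).

(* The empty chain is kept as the face of dimension -1. *)
Definition order_complex : {set {set T}} :=
  [set s : {set T} | (s \subset A) &&
     [forall x in s, [forall y in s, (x >=< y)%O]]].

Definition chain n := {s : {set T} | (s \in order_complex) && (#|s| == n)}.

Variable k : comNzRingType.

(* The degree is shifted by one: these are the cochains of dimension n - 1
   of the augmented cochain complex. *)
Definition cochain n := {ffun chain n -> k}.

(* The vertices of a chain are numbered increasingly, so the face opposite to v
   carries the sign given by the number of vertices below v; that face is again
   a chain (chain_facet), hence the default value 0 is never used. *)
Definition coboundary n (f : cochain n) : cochain n.+1 :=
  [ffun s : chain n.+1 => \sum_(v in val s)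
     (-1) ^+ #|[set w in val s | (w < v)%O]| *
       oapp f 0 (insub (val s :\ v))].

Lemma chain_facet n (s : chain n.+1) v : v \in val s ->
  (val s :\ v \in order_complex) && (#|val s :\ v| == n).
Proof.
case: s => /= s /andP[]; rewrite !inE => /andP[sA sC] /eqP sn vs.
move: (cardsD1 v s); rewrite vs sn add1n => -[<-]; rewrite eqxx andbT.
rewrite (subset_trans (subsetDl _ _) sA) /=.
apply/forall_inP => x; rewrite !inE => /andP[_ xs].
apply/forall_inP => y; rewrite !inE => /andP[_ ys].
by move/forall_inP: sC => /(_ x xs)/forall_inP; apply.
Qed.

Lemma coboundaryK n (f : cochain n) : coboundary (coboundary f) = 0.
Proof.
apply/ffunP => s; rewrite ffunE [RHS]ffunE.
set S := val s.
have chS x y : x \in S -> y \in S -> (x >=< y)%O.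
  case/andP: (valP s); rewrite inE => /andP[_ /forall_inP h] _ xS.
  exact: (forall_inP (h x xS)).
pose P (v : T) := #|[set w in S | (w < v)%O]|.
pose G (v w : T) : k := (-1) ^+ (P v + (P w - (v < w)%O)) *
   oapp f 0 (insub (S :\ v :\ w)).
have step v : v \in S ->
  (-1) ^+ #|[set w in S | (w < v)%O]| *
     oapp (coboundary f) 0 (insub (S :\ v)) = \sum_(w in S | w != v) G v w.
  move=> vS; rewrite insubT /=; first exact: chain_facet.
  move=> pf; rewrite ffunE /= big_distrr /=.
  apply: eq_big => [w|w]; first by rewrite !inE andbC.
  rewrite !inE => /andP[wv wS].
  rewrite mulrA -exprD; congr (_ ^+ (_ + _) * _).
  rewrite /P (cardsD1 v [set u in S | (u < w)%O]) inE vS /= addKn.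
  by apply: eq_card => u; rewrite !inE andbA.
rewrite (eq_bigr _ step) pair_big_dep /=.
rewrite (bigID (fun p => (p.1 < p.2)%O)) /=.
set X := (X in X + _ = _).
suff -> : X = - \sum_(p | [&& p.1 \in S, (p.2 \in S) & p.2 != p.1]
    && ~~ (p.1 < p.2)%O) G p.1 p.2 by rewrite addNr.
rewrite /X [in RHS](reindex_inj (h := fun p : T * T => (p.2, p.1))) /=; last first.
  by move=> [a b] [c e] [-> ->].
rewrite -sumrN; apply: eq_big => [[v w]|[v w]] /=.
  case vS: (v \in S); case wS: (w \in S) => //=.
  rewrite [v == w]eq_sym; case: eqVneq => //= vw.
  by case: (comparable_ltgtP (chS v w vS wS)) vw => // ->; rewrite eqxx.
move=> /andP[/and3P[vS wS _] vw].
rewrite /G vw (lt_gtF vw) /= subn0 setDDl setUC -setDDl.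
have : (0 < P w)%N by apply/card_gt0P; exists v; rewrite inE vS.
case: (P w) => // p _.
by rewrite subn1 /= [in RHS]addSn exprS mulN1r mulNr opprK addnC.
Qed.

(* reduced_cohomology_neq0 n states that the reduced cohomology of dimension
   n - 1 (cocycles modulo coboundaries) is nonzero. *)
Definition reduced_cohomology_neq0 n : Prop :=
  exists f : cochain n, coboundary f = 0 /\
    ~ match n return cochain n -> Prop with
      | 0 => fun f => f = 0
      | m.+1 => fun f => exists g : cochain m, f = coboundary g
      end f.

End OrderComplex.

Section Ext.
Variable A : pzRingType.

Definition projective (P : lmodType A) : Prop :=
  forall (M N : lmodType A) (g : {linear M -> N}) (f : {linear P -> N}),
    (forall y, exists x, g x = y) ->
    exists h : {linear P -> M}, forall p, g (h p) = f p.

Record projective_resolution (M : lmodType A) := ProjectiveResolution {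
  res_obj :> nat -> lmodType A;
  res_diff : forall n, {linear res_obj n.+1 -> res_obj n};
  res_aug : {linear res_obj 0 -> M};
  res_projective : forall n, projective (res_obj n);
  res_aug_surj : forall m, exists x, res_aug x = m;
  res_exact0 : forall x, res_aug x = 0 <-> exists y, x = res_diff 0 y;
  res_exactS : forall n x,
    res_diff n x = 0 <-> exists y, x = res_diff n.+1 y
}.

(* The n-th cohomology group of the complex Hom_A(P, V) is nonzero. *)
Definition hom_cohomology_neq0 (M : lmodType A) (P : projective_resolution M)
    (V : lmodType A) (n : nat) : Prop :=
  exists f : {linear P n -> V},
    (forall x, f (res_diff P n x) = 0) /\
    ~ match n return {linear P n -> V} -> Prop with
      | 0 => fun f => forall x, f x = 0
      | m.+1 => fun f => exists g : {linear P m -> V},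
                  forall x, f x = g (res_diff P m x)
      end f.

(* Ext^n_A(M, V) <> 0; up to isomorphism Ext^n_A(M, V) does not depend on the
   projective resolution used to compute it. *)
Definition Ext_neq0 (n : nat) (M V : lmodType A) : Prop :=
  exists P : projective_resolution M, hom_cohomology_neq0 P V n.

End Ext.

Definition monoid_algebra (k : comNzRingType) (B : finMonoidType) : Type :=
  {ffun B -> k}.

Section MonoidAlgebra.
Variables (k : comNzRingType) (B : finMonoidType).
Local Notation kB := (monoid_algebra k B).
Implicit Types f g h : kB.

HB.instance Definition _ := GRing.Zmodule.copy kB {ffun B -> k}.

Definition malg_one : kB := [ffun b => (b == 1%g)%:R].
Definition malg_mul f g : kB :=
  [ffun b => \sum_(p : B * B | (p.1 * p.2)%g == b) f p.1 * g p.2].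

Lemma malg_mulE f g b :
  malg_mul f g b = \sum_x \sum_(y | (x * y)%g == b) f x * g y.
Proof. by rewrite ffunE pair_big_dep. Qed.

Lemma sum_malg_mul f g (F : B -> k) :
  \sum_b malg_mul f g b * F b = \sum_x \sum_y f x * g y * F (x * y)%g.
Proof.
under eq_bigr do rewrite ffunE big_distrl /=.
rewrite (exchange_big_dep predT) //= pair_big /=.
apply: eq_bigr => -[x y] _ /=.
by rewrite (big_pred1 (x * y)%g) // => b; rewrite /= eq_sym.
Qed.

Lemma malg_mul_delta f g b :
  malg_mul f g b = \sum_x \sum_y f x * g y * ((x * y)%g == b)%:R.
Proof.
rewrite malg_mulE; apply: eq_bigr => x _; rewrite big_mkcond /=.
by apply: eq_bigr => y _; case: eqP; rewrite ?mulr1 ?mulr0.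
Qed.

Lemma malg_mulA : associative malg_mul.
Proof.
move=> f g h; apply/ffunP => b; rewrite !malg_mul_delta.
transitivity (\sum_x \sum_y \sum_z f x * g y * h z * ((x * y * z)%g == b)%:R).
  apply: eq_bigr => x _.
  under eq_bigr do rewrite mulrAC mulrC.
  rewrite sum_malg_mul; apply: eq_bigr => y _; apply: eq_bigr => z _.
  by rewrite !mulgA mulrA [_ * f x]mulrC !mulrA.
under [RHS]eq_bigr do (under eq_bigr do rewrite -mulrA; rewrite -big_distrr).
rewrite /= sum_malg_mul; apply: eq_bigr => x _; apply: eq_bigr => y _.
by rewrite big_distrr; apply: eq_bigr => z _; rewrite /= !mulrA.
Qed.

Lemma malg_mul1 : left_id malg_one malg_mul.
Proof.
move=> f; apply/ffunP => b; rewrite malg_mulE (bigD1 1%g) //=.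
rewrite [X in _ + X]big1 ?addr0 => [|x /negPf x1]; last first.
  by apply: big1 => y _; rewrite ffunE x1 mul0r.
under eq_bigl do rewrite mul1g.
by rewrite big_pred1_eq ffunE eqxx mul1r.
Qed.

Lemma malg_mulr1 : right_id malg_one malg_mul.
Proof.
move=> f; apply/ffunP => b; rewrite malg_mul_delta exchange_big (bigD1 1%g) //=.
rewrite [X in _ + X]big1 ?addr0 => [|x /negPf x1]; last first.
  by apply: big1 => y _; rewrite ffunE x1 mulr0 mul0r.
rewrite (bigD1 b) //= mulg1 ffunE !eqxx !mulr1 big1 ?addr0 // => x /negPf xb.
by rewrite mulg1 xb mulr0.
Qed.

Lemma malg_mulDl : left_distributive malg_mul +%R.
Proof.
move=> f g h; apply/ffunP => b; rewrite !ffunE -big_split.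
by apply: eq_bigr => p _; rewrite ffunE mulrDl.
Qed.

Lemma malg_mulDr : right_distributive malg_mul +%R.
Proof.
move=> f g h; apply/ffunP => b; rewrite !ffunE -big_split.
by apply: eq_bigr => p _; rewrite ffunE mulrDr.
Qed.

Lemma malg_one_neq0 : malg_one != 0.
Proof.
by apply/eqP => /ffunP/(_ 1%g)/eqP; rewrite !ffunE eqxx oner_eq0.
Qed.

HB.instance Definition _ := GRing.Zmodule_isNzRing.Build kB
  malg_mulA malg_mul1 malg_mulr1 malg_mulDl malg_mulDr malg_one_neq0.

Definition augmentation f : k := \sum_b f b.

End MonoidAlgebra.

(* k on which every element of B acts as the identity *)
Definition trivial_module (k : comNzRingType) (B : finMonoidType) : Type := k.

Section TrivialModule.
Variables (k : comNzRingType) (B : finMonoidType).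
Local Notation kB := (monoid_algebra k B).
Local Notation V := (trivial_module k B).

HB.instance Definition _ := GRing.Zmodule.copy V k.

Definition trivial_scale (f : kB) (x : V) : V := (augmentation f * x : k).

Lemma trivial_scaleA f g x :
  trivial_scale f (trivial_scale g x) = trivial_scale (f * g) x.
Proof.
rewrite /trivial_scale mulrA; congr (_ * _); rewrite /augmentation.
have -> : \sum_b (f * g) b = \sum_b malg_mul f g b * 1.
  by apply: eq_bigr => b _; rewrite mulr1.
rewrite sum_malg_mul big_distrlr.
by do 2![apply: eq_bigr => ? _]; rewrite mulr1.
Qed.

Lemma trivial_scale1 : left_id 1 trivial_scale.
Proof.
move=> x; rewrite /trivial_scale /augmentation (bigD1 1%g) //= ffunE eqxx.
by rewrite big1 ?addr0 ?mul1r // => b /negPf b1; rewrite ffunE b1.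
Qed.

Lemma trivial_scaleDr : right_distributive trivial_scale +%R.
Proof. by move=> f x y; rewrite /trivial_scale -mulrDr. Qed.

Lemma trivial_scaleDl x : {morph trivial_scale^~ x : f g / f + g}.
Proof.
move=> f g; rewrite /trivial_scale -mulrDl; congr (_ * _).
by rewrite /augmentation -big_split; apply: eq_bigr => b _; rewrite ffunE.
Qed.

HB.instance Definition _ := GRing.Zmodule_isLmodule.Build kB V
  trivial_scaleA trivial_scale1 trivial_scaleDr trivial_scaleDl.

End TrivialModule.

Definition is_sup (S : nat -> Prop) (n : nat) : Prop :=
  (forall m, S m -> (m <= n)%N) /\
  (forall u, (forall m, S m -> (m <= u)%N) -> (n <= u)%N).

Definition is_largest (S : nat -> Prop) (n : nat) : Prop :=
  S n /\ forall m, S m -> (m <= n)%N.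

(* cd_k B = n; no n satisfies this when the cohomological dimension is
   infinite. *)
Definition is_cohomological_dimension (k : comNzRingType) (B : finMonoidType)
    (n : nat) : Prop :=
  is_sup (fun m => exists V : lmodType (monoid_algebra k B),
            Ext_neq0 m (trivial_module k B) V) n.

(* Main.v *)
(** Let [B] act on the chains of the poset [B] by left multiplication, a chain
  that is shortened being sent to [0]. Since [1] is the maximum of the poset, the
  chain complex of [B] is a resolution of the trivial module. It is projective:
  with [rank z := #|Bz|], the element [e * \prod_(rank z < rank e) (1 - z)] of
  the monoid algebra is killed on the left by every [c] with [e * c <> e] and
  fixes every vector that [e] fixes and that all [z] of rank smaller than [e]
  kill, so lifts of values on basis chains can be made equivariant one rank at a
  time.

  An equivariant cochain that vanishes on the chains whose maximum has rank less
  than [c] restricts, through [S |-> e_Y |: S] with [#|Y| = c], to a cochain of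
  the order complex of the boundary of [e_Y]. Acyclicity of the boundaries over
  [k] above degree [n] gives a contraction, hence acyclicity with coefficients in
  any module, and a cocycle is killed one rank at a time. Conversely a class on
  the boundary of [e_Y] extends to an equivariant cocycle with values in [k], on
  which [b] acts by [1] if [e_Y * b = e_Y] and by [0] otherwise. *)
From HB Require Import structures.
Require Import Defs.
From mathcomp Require Import all_boot all_order all_algebra.
From mathcomp Require Import boolp.

Set Implicit Arguments.
Unset Strict Implicit.
Unset Printing Implicit Defensive.

Import Order.TTheory GRing.Theory.

Local Open Scope ring_scope.

(** * Comparison of projective resolutions *)

Section Image.
Variables (A : pzRingType) (M N : lmodType A) (g : {linear M -> N}).

Definition image_pred : {pred N} := fun y => `[< exists x, g x = y >].

Lemma image_pred_submod : submod_closed image_pred.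
Proof.
split; first by apply/asboolP; exists 0; rewrite linear0.
move=> a _ _ /asboolP[x <-] /asboolP[y <-].
by apply/asboolP; exists (a *: x + y); rewrite linearP.
Qed.

HB.instance Definition _ := GRing.isSubmodClosed.Build A N image_pred image_pred_submod.

Definition image_module := {y | y \in image_pred}.
HB.instance Definition _ := SubChoice.on image_module.
HB.instance Definition _ := [SubChoice_isSubLmodule of image_module by <:].

End Image.

Section Lifting.
Variables (A : pzRingType) (P M N : lmodType A).

(** [projective] only lifts through surjections; corestricting both maps to the image of [g] reduces
    to that case. *)
Lemma projective_lift (g : {linear M -> N}) (f : {linear P -> N}) :
  projective P -> (forall p, exists x, g x = f p) ->
  exists h : {linear P -> M}, forall p, g (h p) = f p.
Proof.
move=> Pproj fg.
have gim x : g x \in image_pred g by apply/asboolP; exists x.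
have fim p : f p \in image_pred g by apply/asboolP.
pose g1 x : image_module g := Sub (g x) (gim x).
pose f1 p : image_module g := Sub (f p) (fim p).
have lg1 : linear g1 by move=> a x y; apply: val_inj; rewrite /= linearP.
have lf1 : linear f1 by move=> a x y; apply: val_inj; rewrite /= linearP.
pose G := GRing.isLinear.Build A M (image_module g) *:%R g1 lg1.
pose F := GRing.isLinear.Build A P (image_module g) *:%R f1 lf1.
pose g2 : {linear M -> image_module g} := HB.pack g1 G.
pose f2 : {linear P -> image_module g} := HB.pack f1 F.
have [y|h hE] := Pproj M (image_module g) g2 f2.
  by have /asboolP[x xy] := valP y; exists x; apply: val_inj.
by exists h => p; have := congr1 val (hE p).
Qed.
End Lifting.

Section Comparison.
Variables (A : pzRingType) (M : lmodType A).
Implicit Types P Q : projective_resolution M.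

Lemma res_diffK P n x : res_diff P n (res_diff P n.+1 x) = 0.
Proof. by apply/res_exactS; exists x. Qed.

Lemma res_aug_diff P x : res_aug P (res_diff P 0 x) = 0.
Proof. by apply/res_exact0; exists x. Qed.

Lemma lift_to_1 (X : lmodType A) Q (f : {linear X -> Q 0}) :
  projective X -> (forall x, res_aug Q (f x) = 0) ->
  exists h : {linear X -> Q 1}, forall x, res_diff Q 0 (h x) = f x.
Proof.
move=> Xproj f0; apply: projective_lift Xproj _ => x.
by have /res_exact0[y ->] := f0 x; exists y.
Qed.

Lemma lift_to_S (X : lmodType A) Q n (f : {linear X -> Q n.+1}) :
  projective X -> (forall x, res_diff Q n (f x) = 0) ->
  exists h : {linear X -> Q n.+2}, forall x, res_diff Q n.+1 (h x) = f x.
Proof.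
move=> Xproj f0; apply: projective_lift Xproj _ => x.
by have /res_exactS[y ->] := f0 x; exists y.
Qed.

Lemma lift_aug P Q :
  exists (f : {linear P 0 -> Q 0}) (f' : {linear P 1 -> Q 1}),
    (forall x, res_aug Q (f x) = res_aug P x) /\
    (forall x, res_diff Q 0 (f' x) = f (res_diff P 0 x)).
Proof.
have [f fE] := projective_lift (g := res_aug Q) (f := res_aug P)
  (@res_projective _ _ P 0) (fun p => res_aug_surj Q _).
have [f' f'E] := @lift_to_1 _ Q (f \o res_diff P 0) (@res_projective _ _ P 1)
  (fun x => etrans (fE _) (res_aug_diff x)).
by exists f, f'.
Qed.

Lemma lift_step P Q n (f : {linear P n -> Q n}) (f' : {linear P n.+1 -> Q n.+1}) :
  (forall x, res_diff Q n (f' x) = f (res_diff P n x)) ->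
  exists f'' : {linear P n.+2 -> Q n.+2},
    forall x, res_diff Q n.+1 (f'' x) = f' (res_diff P n.+1 x).
Proof.
move=> ff'; apply: (@lift_to_S _ Q n (f' \o res_diff P n.+1)) => [|x].
  exact: res_projective.
by rewrite /= ff' res_diffK linear0.
Qed.

(** Only two consecutive degrees of the chain maps and of the homotopy are carried: the next degree
    is lifted from these alone, so no infinite family has to be chosen. *)
Lemma resolution_homotopy P Q n :
  exists (f : {linear P n -> Q n}) (f' : {linear P n.+1 -> Q n.+1})
         (g : {linear Q n -> P n}) (g' : {linear Q n.+1 -> P n.+1})
         (h : {linear P n -> P n.+1}) (h' : {linear P n.+1 -> P n.+2}),
    [/\ forall x, res_diff Q n (f' x) = f (res_diff P n x),
        forall y, res_diff P n (g' y) = g (res_diff Q n y) &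
        forall x, g' (f' x) - x = res_diff P n.+1 (h' x) + h (res_diff P n x)].
Proof.
elim: n => [|n [f [f' [g [g' [h [h' [ff' gg' hh']]]]]]]].
  have [f [f' [fE ff']]] := lift_aug P Q; have [g [g' [gE gg']]] := lift_aug Q P.
  have [x|h hE] := @lift_to_1 _ P (g \o f \- idfun) (@res_projective _ _ P 0).
    by rewrite /= linearB /= gE fE subrr.
  have [x|h' h'E] := @lift_to_S _ P 0 (g' \o f' \- idfun \- (h \o res_diff P 0))
      (@res_projective _ _ P 1).
    by rewrite /= !linearB /= gg' ff' hE /= subrr.
  exists f, f', g, g', h, h'; split=> // x.
  by rewrite h'E /= subrK.
have [f'' ff''] := lift_step ff'; have [g'' gg''] := lift_step gg'.
have [x|h'' h''E] := @lift_to_S _ P n.+1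
    (g'' \o f'' \- idfun \- (h' \o res_diff P n.+1)) (@res_projective _ _ P n.+2).
  rewrite /= !linearB /= gg'' ff''.
  have /esym/eqP := hh' (res_diff P n.+1 x).
  by rewrite res_diffK linear0 addr0 => /eqP <-; rewrite subrr.
exists f', f'', g', g'', h', h''; split=> // x.
by rewrite h''E /= subrK.
Qed.

(* g' extends to the next degree, hence it pulls cocycles back to cocycles. *)
Lemma hom_cohomology_transfer P Q (V : lmodType A) n :
  hom_cohomology_neq0 P V n.+1 -> hom_cohomology_neq0 Q V n.+1.
Proof.
have [f [f' [g [g' [h [h' [ff' gg' hh']]]]]]] := resolution_homotopy P Q n.
have [g'' gg''] := lift_step gg'.
move=> [c [c0 cN]]; exists (c \o g'); split=> [y|[b bE]] /=.
  by rewrite -gg'' c0.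
(* As [c] kills boundaries, the homotopy identity gives [c = c \o g' \o f' - c \o h \o d], and [c \o
   g' \o f' = b \o d \o f' = b \o f \o d]. *)
apply: cN; exists ((b \o f) \- (c \o h)) => x /=.
have /(congr1 c) := hh' x; rewrite linearB linearD /= c0 add0r => <-.
by rewrite opprB addrC -ff' -bE /= subrK.
Qed.

End Comparison.

(** * Reduced cochains with coefficients *)

Section SignedSums.
Variables (d : Order.disp_t) (T : finPOrderType d).
Implicit Types (S U : {set T}) (v e : T).

Definition below S v := #|[set w in S | (w < v)%O]|.

(* [coboundary] for cochains with values in an arbitrary abelian group, extended
   to all sets of vertices. *)
Definition cob (V : zmodType) (Phi : {set T} -> V) S : V :=
  \sum_(v in S) Phi (S :\ v) *~ (-1) ^+ below S v.

Lemma eq_cob (V : zmodType) (Phi Psi : {set T} -> V) S :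
  (forall v, v \in S -> Phi (S :\ v) = Psi (S :\ v)) -> cob Phi S = cob Psi S.
Proof. by move=> PhiPsi; apply: eq_bigr => v vS; rewrite PhiPsi. Qed.

Lemma raddf_cob (V W : zmodType) (f : {additive V -> W}) (Phi : {set T} -> V) S :
  f (cob Phi S) = cob (f \o Phi) S.
Proof. by rewrite raddf_sum; apply: eq_bigr => v _; rewrite raddfMz. Qed.

(** Omitting [e] leaves [S], with the sign counting all of [S] below [e]; omitting [v] in [S] leaves
    a cone with unchanged sign, because [e] is not below [v]. *)
Lemma cob_cone (V : zmodType) (Phi : {set T} -> V) e S :
  (forall v, v \in S -> (v < e)%O) ->
  cob Phi (e |: S) =
    Phi S *~ (-1) ^+ #|S| + cob (fun U => Phi (e |: U)) S.
Proof.
move=> ltSe; have eS : e \notin S by apply/negP => /ltSe; rewrite ltxx.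
rewrite /cob big_setU1 //= setU1K //; congr (_ *~ (-1) ^+ _ + _).
  apply: eq_card => w; rewrite !inE.
  by case: eqP => [->|_] /=; [rewrite ltxx (negPf eS)|case wS: (_ \in _) => //=; exact: ltSe].
apply: eq_bigr => v vS; congr (Phi _ *~ (-1) ^+ _).
  rewrite setDUl; congr (_ :|: _); apply/setDidPl.
  by rewrite disjoints1 inE; apply: contra eS => /eqP ->.
apply: eq_card => w; rewrite !inE; case: eqP => [->|_] //=.
by rewrite (negPf eS) /=; apply: lt_gtF; exact: ltSe.
Qed.

End SignedSums.

Lemma sum_pred1 (R : pzSemiRingType) (I : finType) (F : I -> R) i :
  \sum_j F j * (j == i)%:R = F i.
Proof.
by rewrite (bigD1 i) //= eqxx mulr1 big1 ?addr0 // => j /negPf ->; rewrite mulr0.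
Qed.

(** * Acyclicity over [k] and change of coefficients *)

Section Coefficients.
Variables (d : Order.disp_t) (T : finPOrderType d) (A : {set T}).
Variables (k : comNzRingType) (R : pzRingType) (iota : {rmorphism k -> R}).
Variable V : lmodType R.

Definition dual_basis n (t : chain A n) : cochain A k n := [ffun s => (s == t)%:R].

Definition facet n (s : chain A n.+1) v (vs : v \in val s) : chain A n :=
  exist _ (val s :\ v) (chain_facet vs).

Lemma insub_facet n (s : chain A n.+1) v (vs : v \in val s) :
  insub (val s :\ v) = Some (facet vs).
Proof. by rewrite insubT ?chain_facet // => p; congr Some; apply: val_inj. Qed.

(** The matrix of the coboundary; having entries in [k], it acts on cochains with values in any
    module through [iota]. *)
Definition incidence n (s : chain A n.+1) (t : chain A n) : k :=
  coboundary (dual_basis t) s.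

Lemma incidenceE n (s : chain A n.+1) t :
  incidence s t = \sum_(v in val s) (-1) ^+ below (val s) v * (val s :\ v == val t)%:R.
Proof.
rewrite /incidence ffunE; apply: eq_bigr => v vs; congr (_ * _).
by rewrite (insub_facet vs) /= ffunE.
Qed.

Lemma sum_facet n (W : zmodType) (F : chain A n -> W) (s : chain A n.+1) v :
  v \in val s ->
  \sum_t (if val s :\ v == val t then F t else 0) = oapp F 0 (insub (val s :\ v)).
Proof.
move=> vs; rewrite (insub_facet vs) /= -big_mkcond /=.
by rewrite (big_pred1 (facet vs)) // => t /=; rewrite eq_sym.
Qed.

Lemma coboundaryE n (f : cochain A k n) s :
  coboundary f s = \sum_t incidence s t * f t.
Proof.
rewrite ffunE; under [RHS]eq_bigr do rewrite incidenceE big_distrl.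
rewrite exchange_big; apply: eq_bigr => v vs /=.
rewrite -sum_facet // big_distrr; apply: eq_bigr => t _ /=.
by case: eqP; rewrite ?mulr1 ?mulr0 ?mul0r.
Qed.

Lemma cob_incidence n (Phi : {set T} -> V) (s : chain A n.+1) :
  cob Phi (val s) = \sum_t iota (incidence s t) *: Phi (val t).
Proof.
under [RHS]eq_bigr do rewrite incidenceE raddf_sum scaler_suml.
rewrite exchange_big; apply: eq_bigr => v vs /=.
rewrite (_ : Phi _ = oapp (Phi \o val) 0 (insub (val s :\ v) : option (chain A n))).
  rewrite -sum_facet // mulrz_suml; apply: eq_bigr => t _ /=.
  rewrite rmorphM rmorphXn rmorphN1.
  case: eqP => _; rewrite ?rmorph1 ?rmorph0 ?mulr1 ?mulr0 ?scale0r ?mul0rz //.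
  by rewrite -[in RHS]intr_sign scaler_int.
by rewrite (insub_facet vs).
Qed.

Lemma incidenceK n (u : chain A n.+2) (s : chain A n) :
  \sum_t incidence u t * incidence t s = 0.
Proof. by rewrite -coboundaryE coboundaryK ffunE. Qed.

(** [h] and [h'] list the images of the dual basis under two degree-lowering maps; the equation is
    the homotopy identity [d h + h' d = id] at the dual basis cochain of [s], evaluated at [s']. *)
Definition contraction j (h : chain A j.+1 -> cochain A k j)
    (h' : chain A j.+2 -> cochain A k j.+1) :=
  forall s s', coboundary (h s) s' + \sum_u incidence u s * h' u s' = (s' == s)%:R.

(** Descending induction on the degree, starting where no chain is long enough. Given [h'] one
    degree up, [id - h' d] takes values in cocycles, hence in coboundaries, and [h s] is a chosen
    primitive. *)
Lemma acyclic_contraction n :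
    (forall m, (n < m)%N -> ~ reduced_cohomology_neq0 A k m) ->
  forall j, (n <= j)%N -> exists h h', @contraction j h h'.
Proof.
move=> acyclic j nj.
have [N] : exists N, (#|T| <= N + j)%N by exists #|T|; rewrite leq_addr.
elim: N j nj => [|N IH] j nj Nj.
  exists (fun=> 0), (fun=> 0) => s.
  have /andP[_ /eqP s_card] := valP s.
  by have := max_card (mem (val s)); rewrite s_card leqNgt ltnS Nj.
have Nj' : (#|T| <= N + j.+1)%N by rewrite addnS.
have [h' [h'' hh]] := IH j.+1 (leqW nj) Nj'.
suff /fin_all_exists[h hE] : forall s, exists g : cochain A k j,
    [ffun s' => (s' == s)%:R - \sum_u incidence u s * h' u s'] = coboundary g.
  exists h, h' => s s'.
  by have /ffunP/(_ s') := hE s; rewrite ffunE => <-; rewrite subrK.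
move=> s; apply: contrapT => no_g; apply: (acyclic j.+1 nj).
eexists; split; last exact: no_g.
apply/ffunP => u; rewrite coboundaryE [RHS]ffunE.
have h'E w : coboundary (h' w) u =
    (u == w)%:R - \sum_v incidence v w * h'' v u by rewrite -hh addrK.
under eq_bigr do rewrite ffunE mulrBr.
rewrite sumrB sum_pred1 -[X in X - _](sum_pred1 (fun w => incidence w s) u).
under [X in _ - X]eq_bigr do rewrite big_distrr /=.
rewrite exchange_big -sumrB /=.
transitivity (\sum_w incidence w s * \sum_v incidence v w * h'' v u).
  apply: eq_bigr => w _; under [X in _ - X]eq_bigr do rewrite mulrCA.
  rewrite -big_distrr -coboundaryE h'E /=.
  by rewrite [u == w]eq_sym mulrBr subKr.
under eq_bigr do rewrite big_distrr /=.
rewrite exchange_big big1 // => v _.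
under eq_bigr do rewrite mulrA [incidence _ s * _]mulrC.
by rewrite -big_distrl /= incidenceK mul0r.
Qed.

(** The contraction is a matrix over [k], so its identity persists for values in [V]; on a cocycle
    the term [h' d] vanishes and [h] yields the primitive [Theta]. *)
Lemma acyclic_coefficients n :
    (forall m, (n < m)%N -> ~ reduced_cohomology_neq0 A k m) ->
  forall j (Phi : {set T} -> V), (n <= j)%N ->
    (forall u : chain A j.+2, cob Phi (val u) = 0) ->
  exists Theta : {set T} -> V, forall s : chain A j.+1, cob Theta (val s) = Phi (val s).
Proof.
move=> acyclic j Phi nj Phi0.
have [h [h' hh]] := acyclic_contraction acyclic nj.
exists (fun S => oapp (fun t => \sum_s iota (h s t) *: Phi (val s)) 0 (insub S)) => s'.
rewrite cob_incidence.
under eq_bigr do rewrite valK /= scaler_sumr.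
rewrite exchange_big /=.
transitivity (\sum_s iota (coboundary (h s) s') *: Phi (val s)).
  apply: eq_bigr => s _; rewrite coboundaryE rmorph_sum scaler_suml.
  by apply: eq_bigr => t _; rewrite scalerA rmorphM.
have hE s : coboundary (h s) s' =
    (s' == s)%:R - \sum_u incidence u s * h' u s' by rewrite -hh addrK.
under eq_bigr do rewrite hE rmorphB scalerBl rmorph_sum scaler_suml.
rewrite sumrB (bigD1 s') //= eqxx rmorph1 scale1r big1 => [|s]; last first.
  by rewrite eq_sym => /negPf ->; rewrite rmorph0 scale0r.
rewrite addr0 exchange_big big1 ?subr0 // => u _ /=.
transitivity (iota (h' u s') *: cob Phi (val u)); last by rewrite Phi0 scaler0.
rewrite cob_incidence scaler_sumr; apply: eq_bigr => s _.
by rewrite scalerA -rmorphM mulrC.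
Qed.

End Coefficients.

(** * The chain modules *)

Section MonoidAlgebraBasis.
Variables (k : comNzRingType) (B : finMonoidType).
Local Notation kB := (monoid_algebra k B).
Implicit Types (a f : kB) (x y : k) (b c : B).

Definition malg_delta b : kB := [ffun c => (c == b)%:R].
Definition malg_const x : kB := [ffun b => x * (b == 1%g)%:R].

Lemma malgME a f b :
  (a * f) b = \sum_c \sum_u a c * f u * ((c * u)%g == b)%:R.
Proof. exact: malg_mul_delta. Qed.

Lemma malg_constM x f b : (malg_const x * f) b = x * f b.
Proof.
rewrite malgME (bigD1 1%g) //= [X in _ + X]big1 ?addr0 => [|c /negPf c1]; last first.
  by apply: big1 => u _; rewrite ffunE c1 mulr0 !mul0r.
rewrite (bigD1 b) //= mul1g ffunE !eqxx !mulr1 big1 ?addr0 // => u /negPf ub.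
by rewrite mul1g ub mulr0.
Qed.

Lemma malg_Mconst x f b : (f * malg_const x) b = x * f b.
Proof.
rewrite malgME exchange_big (bigD1 1%g) //= [X in _ + X]big1 ?addr0; last first.
  by move=> c /negPf c1; apply: big1 => u _; rewrite ffunE c1 !mulr0 !mul0r.
rewrite (bigD1 b) //= mulg1 ffunE !eqxx !mulr1 big1 ?addr0 1?mulrC // => u /negPf ub.
by rewrite mulg1 ub mulr0.
Qed.

Lemma malg_const_comm x f : malg_const x * f = f * malg_const x.
Proof. by apply/ffunP => b; rewrite malg_constM malg_Mconst. Qed.

Lemma malg_const_is_zmod_morphism : zmod_morphism malg_const.
Proof. by move=> x y; apply/ffunP => b; rewrite !ffunE mulrBl. Qed.

Lemma malg_const_is_monoid_morphism : monoid_morphism malg_const.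
Proof.
split; first by apply/ffunP => b; rewrite !ffunE mul1r.
by move=> x y; apply/ffunP => b; rewrite malg_constM !ffunE mulrA.
Qed.

HB.instance Definition _ := GRing.isZmodMorphism.Build k kB malg_const
  malg_const_is_zmod_morphism.
HB.instance Definition _ := GRing.isMonoidMorphism.Build k kB malg_const
  malg_const_is_monoid_morphism.

Lemma malg_deltaM b c : malg_delta b * malg_delta c = malg_delta (b * c)%g.
Proof.
apply/ffunP => u; rewrite malgME (bigD1 b) //= [X in _ + X]big1 ?addr0; last first.
  by move=> v /negPf vb; apply: big1 => w _; rewrite ffunE vb !mul0r.
rewrite (bigD1 c) //= [X in _ + X]big1 ?addr0; last first.
  by move=> w /negPf wc; rewrite [malg_delta c w]ffunE wc mulr0 mul0r.
by rewrite !ffunE !eqxx !mul1r eq_sym.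
Qed.

Lemma malgE a : a = \sum_b malg_const (a b) * malg_delta b.
Proof.
apply/ffunP => c; rewrite sum_ffunE (bigD1 c) //= malg_constM ffunE eqxx mulr1.
by rewrite big1 ?addr0 // => b /negPf bc; rewrite malg_constM ffunE eq_sym bc mulr0.
Qed.

Lemma scale_malgE (V : lmodType kB) a (v : V) :
  a *: v = \sum_b malg_const (a b) *: (malg_delta b *: v).
Proof. by rewrite {1}[a]malgE scaler_suml; apply: eq_bigr => b _; rewrite scalerA. Qed.

Lemma augmentation_delta b : augmentation (malg_delta b) = 1.
Proof.
rewrite /augmentation (bigD1 b) //= ffunE eqxx big1 ?addr0 // => c /negPf cb.
by rewrite ffunE cb.
Qed.

Lemma augmentation_const x : augmentation (malg_const x) = x.
Proof.
rewrite /augmentation (bigD1 1%g) //= ffunE eqxx mulr1 big1 ?addr0 // => c /negPf cb.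
by rewrite ffunE cb mulr0.
Qed.

End MonoidAlgebraBasis.

(** * Action of the band on chains *)

Section ChainModule.
Variables (k : comNzRingType) (B : finLRBType).
Local Notation T := (lrb_poset B).
Local Notation kB := (monoid_algebra k B).
Implicit Types (S U : {set T}) (b c : B) (x y : T).

Definition lact b S : {set T} := [set ((b * (x : B))%g : T) | x in S].

Definition is_chain n S := (S \in order_complex [set: T]) && (#|S| == n).

Definition Chain n S (Sch : is_chain n S) : chain [set: T] n := exist _ S Sch.

Lemma lrb_leE x y : (x <= y)%O = ((y : B) * (x : B) == x)%g.
Proof. by []. Qed.

(** By regularity [b * y * b * x = b * y * x]. *)
Lemma lact_mono b x y : (x <= y)%O -> ((b * (x : B))%g <= (b * (y : B))%g :> T)%O.
Proof. by rewrite !lrb_leE mulgA lrb_regular -mulgA => /eqP->. Qed.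

Lemma order_complexP S :
  reflect {in S &, forall x y, (x >=< y)%O} (S \in order_complex [set: T]).
Proof.
rewrite inE subsetT /=; apply: (iffP forall_inP) => [h x y xS yS | h x xS].
  exact: (forall_inP (h x xS)).
by apply/forall_inP => y yS; exact: h.
Qed.

Lemma lact_complex b S :
  S \in order_complex [set: T] -> lact b S \in order_complex [set: T].
Proof.
move/order_complexP => h; apply/order_complexP => _ _ /imsetP[x xS ->] /imsetP[y yS ->].
by have /orP[/(lact_mono b)|/(lact_mono b)] := h x y xS yS; rewrite /Order.comparable => ->;
  rewrite ?orbT.
Qed.

Lemma lact_mul b c S : lact (b * c)%g S = lact b (lact c S).
Proof. by rewrite /lact -imset_comp; apply: eq_imset => x /=; rewrite mulgA. Qed.

Lemma lact1 S : lact 1%g S = S.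
Proof. by rewrite /lact (eq_imset (g := id)) ?imset_id // => x; rewrite mul1g. Qed.

(** If no element is lost under [b * c], none is lost under [c] already. This makes the action that
    sends shortened chains to zero associative. *)
Lemma is_chain_lact n b c S :
  is_chain n S -> is_chain n (lact (b * c)%g S) -> is_chain n (lact c S).
Proof.
rewrite lact_mul => /andP[SC /eqP Sn] /andP[_ /eqP bcS].
rewrite /is_chain lact_complex //= eqn_leq -{1}Sn leq_imset_card /=.
by rewrite -{1}bcS leq_imset_card.
Qed.

Lemma is_chainS n S v : is_chain n.+1 S -> v \in S -> is_chain n (S :\ v).
Proof. by move=> Sch vS; exact: (@chain_facet _ _ [set: T] n (Chain Sch)). Qed.

Definition chain_module (n : nat) : Type := {ffun chain [set: T] n -> k}.
HB.instance Definition _ n := GRing.Zmodule.copy (chain_module n)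
  {ffun chain [set: T] n -> k}.

Section Module.
Variable n : nat.
Implicit Types (f g : chain_module n) (t : chain [set: T] n) (a : kB).

(** Every [t] has [n] elements, so a chain shortened by [b] contributes to no coefficient: it is
    sent to zero. *)
Definition chain_push b f : chain_module n :=
  [ffun t => \sum_(s | lact b (val s) == val t) f s].

Definition chain_scale a f : chain_module n :=
  [ffun t => \sum_b a b * chain_push b f t].

Lemma chain_pushM b c f : chain_push b (chain_push c f) = chain_push (b * c)%g f.
Proof.
apply/ffunP => t; rewrite !ffunE; under eq_bigr do rewrite ffunE.
rewrite (exchange_big_dep (fun s => lact (b * c)%g (val s) == val t)) /=; last first.
  by move=> u s /eqP <- /eqP <-; rewrite lact_mul.
apply: eq_bigr => s /eqP st.
have csch : is_chain n (lact c (val s)).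
  by apply: (@is_chain_lact n b) => //; [exact: valP | rewrite st; exact: valP].
rewrite (big_pred1 (Chain csch)) // => u; apply/andP/eqP => [[_ /eqP E]|->].
  exact: val_inj.
by rewrite /= -lact_mul st !eqxx.
Qed.

Lemma chain_push_sum b (I : finType) (x : I -> k) (f : I -> chain_module n) t :
  chain_push b [ffun t => \sum_i x i * f i t] t = \sum_i x i * chain_push b (f i) t.
Proof.
rewrite ffunE; under eq_bigr do rewrite ffunE.
by rewrite exchange_big; apply: eq_bigr => i _; rewrite ffunE big_distrr.
Qed.

Lemma chain_scaleA a a' f : chain_scale a (chain_scale a' f) = chain_scale (a * a') f.
Proof.
apply/ffunP => t; rewrite [LHS]ffunE [RHS]ffunE (@sum_malg_mul k B a a').
apply: eq_bigr => b _; rewrite chain_push_sum big_distrr.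
by apply: eq_bigr => c _; rewrite /= mulrA chain_pushM.
Qed.

Lemma chain_scale1 : left_id 1 chain_scale.
Proof.
move=> f; apply/ffunP => t; rewrite ffunE (bigD1 1%g) //= big1 ?addr0; last first.
  by move=> b /negPf b1; rewrite ffunE b1 mul0r.
rewrite [X in X * _]ffunE eqxx mul1r ffunE; rewrite (big_pred1 t) // => s.
by rewrite lact1 /= val_eqE.
Qed.

Lemma chain_scaleDr : right_distributive chain_scale +%R.
Proof.
move=> a f g; apply/ffunP => t.
have pushD b : chain_push b (f + g) t = chain_push b f t + chain_push b g t.
  by rewrite !ffunE -big_split; apply: eq_bigr => s _; rewrite ffunE.
rewrite ffunE [RHS]ffunE [chain_scale a f t]ffunE [chain_scale a g t]ffunE -big_split.
by apply: eq_bigr => b _; rewrite pushD mulrDr.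
Qed.

Lemma chain_scaleDl f : {morph chain_scale^~ f : a a' / a + a'}.
Proof.
move=> a a'; apply/ffunP => t.
rewrite ffunE [RHS]ffunE [chain_scale a f t]ffunE [chain_scale a' f t]ffunE -big_split.
by apply: eq_bigr => b _; rewrite ffunE mulrDl.
Qed.

HB.instance Definition _ := GRing.Zmodule_isLmodule.Build kB (chain_module n)
  chain_scaleA chain_scale1 chain_scaleDr chain_scaleDl.

Lemma chain_scaleE a f t : (a *: f) t = \sum_b a b * chain_push b f t.
Proof. by rewrite ffunE. Qed.

(* Zero when [S] is not a chain with [n] elements. *)
Definition chain_basis S : chain_module n := [ffun t => (val t == S)%:R].

Lemma scale_delta_chain b S :
  is_chain n S -> malg_delta k b *: chain_basis S = chain_basis (lact b S).
Proof.
move=> Sch; apply/ffunP => t; rewrite chain_scaleE (bigD1 b) //= big1 ?addr0; last first.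
  by move=> c /negPf cb; rewrite ffunE cb mul0r.
rewrite ffunE eqxx mul1r !ffunE big_mkcond (bigD1 (Chain Sch)) //= big1 ?addr0.
  by rewrite ffunE eqxx eq_sym; case: eqP.
by move=> s; rewrite -val_eqE ffunE /= => /negPf ->; case: ifP.
Qed.

Lemma chain_basis0 S : ~~ is_chain n S -> chain_basis S = 0.
Proof.
move=> nS; apply/ffunP => t; rewrite !ffunE; case: eqP => // E.
by move: nS; rewrite -E /is_chain (valP t).
Qed.

Lemma scale_const_chain (x : k) f t : (malg_const B x *: f) t = x * f t.
Proof.
rewrite chain_scaleE (bigD1 1%g) //= big1 ?addr0 => [|b /negPf b1]; last first.
  by rewrite ffunE b1 mulr0 mul0r.
rewrite ffunE eqxx mulr1 ffunE (big_pred1 t) // => s.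
by rewrite lact1 /= val_eqE.
Qed.

Lemma chain_moduleE f : f = \sum_s malg_const B (f s) *: chain_basis (val s).
Proof.
apply/ffunP => t; rewrite sum_ffunE (bigD1 t) //= scale_const_chain ffunE eqxx mulr1.
rewrite big1 ?addr0 // => s /negPf st; rewrite scale_const_chain ffunE.
by rewrite val_eqE eq_sym st mulr0.
Qed.

Section Extension.
Variable V : lmodType kB.
Implicit Type Phi : {set T} -> V.

Definition linear_extension Phi f : V := \sum_s malg_const B (f s) *: Phi (val s).

(** Conditions for values on basis chains to define a [kB]-linear map; by the first clause, the
    second reads [b Phi(S) = 0] when [b] shortens [S]. *)
Definition equivariant Phi :=
  (forall S, ~~ is_chain n S -> Phi S = 0) /\
  (forall b S, is_chain n S -> malg_delta k b *: Phi S = Phi (lact b S)).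

Lemma linear_extension_basis Phi S : is_chain n S ->
  linear_extension Phi (chain_basis S) = Phi S.
Proof.
move=> Sch; rewrite /linear_extension (bigD1 (Chain Sch)) //= ffunE eqxx.
rewrite rmorph1 scale1r big1 ?addr0 // => s; rewrite -val_eqE ffunE /= => /negPf ->.
by rewrite rmorph0 scale0r.
Qed.

Lemma linear_extensionB Phi f g :
  linear_extension Phi (f - g) = linear_extension Phi f - linear_extension Phi g.
Proof.
rewrite -sumrB; apply: eq_bigr => s _.
by rewrite -scalerBl -raddfB !ffunE.
Qed.

HB.instance Definition _ Phi := GRing.isZmodMorphism.Build (chain_module n) V
  (linear_extension Phi) (linear_extensionB Phi).

Lemma linear_extension_const Phi (x : k) f :
  linear_extension Phi (malg_const B x *: f) = malg_const B x *: linear_extension Phi f.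
Proof.
rewrite [RHS]scaler_sumr; apply: eq_bigr => s _.
by rewrite scale_const_chain rmorphM scalerA.
Qed.

(** Constants are central in [kB], so it suffices to let a basis element act on a basis chain. *)
Lemma equivariant_scalable Phi : equivariant Phi -> scalable (linear_extension Phi).
Proof.
move=> [Phi0 PhiE] a f; rewrite scale_malgE [RHS]scale_malgE raddf_sum.
apply: eq_bigr => b _; rewrite /= linear_extension_const; congr (_ *: _).
rewrite {1}[f]chain_moduleE [in RHS]/linear_extension !scaler_sumr raddf_sum.
apply: eq_bigr => s _ /=; rewrite !scalerA -!malg_const_comm -!scalerA.
rewrite linear_extension_const; congr (_ *: _).
rewrite scale_delta_chain ?PhiE; try exact: valP.
have [bch|nch] := boolP (is_chain n (lact b (val s))).
  exact: linear_extension_basis.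
by rewrite chain_basis0 // raddf0 Phi0.
Qed.

Lemma equivariant_extension Phi : equivariant Phi ->
  exists F : {linear chain_module n -> V}, F =1 linear_extension Phi.
Proof.
move=> /equivariant_scalable PhiL.
pose L := GRing.isScalable.Build kB (chain_module n) V *:%R _ PhiL.
pose F : {linear chain_module n -> V} := HB.pack (linear_extension Phi) L.
by exists F.
Qed.

Lemma eq_on_basis (F G : {linear chain_module n -> V}) :
  (forall S, is_chain n S -> F (chain_basis S) = G (chain_basis S)) -> F =1 G.
Proof.
move=> FG f; rewrite [f]chain_moduleE !linear_sum; apply: eq_bigr => s _ /=.
by rewrite !linearZ /= FG //; exact: valP.
Qed.

End Extension.
End Module.
End ChainModule.

(** * Ranks and separating elements *)

Section Band.
Variable B : finLRBType.
Local Notation T := (lrb_poset B).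
Implicit Types (S U : {set T}) (b c e z : B) (x y t : T).

(** First [e b = e b c b = e b c = e], then [e c = e b c = e]. Thus the elements fixing [e] on the
    right are closed under taking factors. *)
Lemma lrb_fix_mul e b c : (e * (b * c) = e)%g -> (e * b = e)%g /\ (e * c = e)%g.
Proof.
move=> ebc; have eb : (e * b = e)%g.
  by rewrite -{1}ebc -!mulgA [(b * (c * b))%g]mulgA lrb_regular.
by split; rewrite // -{1}eb -mulgA.
Qed.

Lemma left_idealP b c : reflect (c * b = c)%g (c \in left_ideal b).
Proof.
apply: (iffP imsetP) => [[x _ ->]|cb]; first by rewrite -mulgA lrb_idem.
by exists c.
Qed.

Lemma left_ideal_id b : b \in left_ideal b.
Proof. by apply/left_idealP; rewrite lrb_idem. Qed.

Lemma left_idealS b c : (b * c = b)%g -> left_ideal b \subset left_ideal c.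
Proof.
move=> bc; apply/subsetP => x /left_idealP xb; apply/left_idealP.
by rewrite -xb -mulgA bc.
Qed.

Definition rank b := #|left_ideal b|.

Lemma rank_mulr b c : (rank (b * c)%g <= rank b)%N.
Proof.
rewrite /rank (_ : left_ideal (b * c)%g = [set (x * c)%g | x in left_ideal b]).
  exact: leq_imset_card.
by rewrite /left_ideal -imset_comp; apply: eq_imset => x /=; rewrite mulgA.
Qed.

(** The ideal of [c * e] lies in that of [e], so the ranks force equality; then [e * c * e = e], and
    [e] is fixed by the factor [c]. *)
Lemma rank_le_fix e c : (rank e <= rank (c * e)%g)%N -> (e * c = e)%g.
Proof.
move=> le_e; have sub : left_ideal (c * e)%g \subset left_ideal e.
  by apply: left_idealS; rewrite -mulgA lrb_idem.
have /eqP eqI : left_ideal (c * e)%g == left_ideal e by rewrite eqEcard sub.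
have /left_idealP : e \in left_ideal (c * e)%g by rewrite eqI left_ideal_id.
by case/lrb_fix_mul.
Qed.

Lemma left_ideal_eq e c :
  (e * c = e)%g -> (rank c <= rank e)%N -> left_ideal c = left_ideal e.
Proof. by move=> ec le_c; apply/esym/eqP; rewrite eqEcard left_idealS. Qed.

Definition top S : B :=
  odflt (1%g : T) [pick t in S | [forall x in S, (x <= t)%O]].

Lemma top_unique S t : t \in S -> {in S, forall x, (x <= t)%O} -> top S = t.
Proof.
move=> tS tmax; rewrite /top; case: pickP => [u /andP[uS /forall_inP umax]|/(_ t)].
  by apply: (@le_anti _ T); rewrite (tmax u uS) umax.
by rewrite tS => /negP[]; apply/forall_inP.
Qed.

Lemma top_max n S : is_chain n.+1 S ->
  (top S : T) \in S /\ {in S, forall x, (x <= top S)%O}.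
Proof.
case/andP => /order_complexP Scomp /eqP Sn.
have [x0 x0S] : exists x0, x0 \in S by apply/card_gt0P; rewrite Sn.
(* The maximum of a chain is found as the element with the most elements of [S] below it. *)
case: (@arg_maxnP _ x0 (mem S) (fun t => #|[set w in S | (w <= t)%O]|) x0S) => t tS tmax.
suff le_t : {in S, forall x, (x <= t)%O} by rewrite (top_unique tS le_t).
move=> x xS; case: (comparable_leP (Scomp x t xS tS)) => // ltx.
have := tmax x xS; rewrite /= leqNgt => /negP[]; apply/proper_card/properP; split.
  apply/subsetP => w; rewrite !inE => /andP[-> /le_trans]; apply; exact: ltW.
by exists x; rewrite !inE xS ?lexx // lt_geF.
Qed.

Lemma top_lact n S b : is_chain n.+1 S -> top (lact b S) = (b * top S)%g.
Proof.
case/top_max => tS tmax; apply: top_unique; first by apply: imset_f tS.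
by move=> _ /imsetP[x xS ->]; apply: lact_mono; exact: tmax.
Qed.

Lemma lact_top n S : is_chain n.+1 S -> lact (top S) S = S.
Proof.
case/top_max => tS tmax; rewrite /lact (eq_in_imset (g := id)) ?imset_id // => x xS.
exact/eqP/tmax.
Qed.

Lemma is_chain_card n S : is_chain n S -> #|S| = n.
Proof. by case/andP => _ /eqP. Qed.

Lemma not_chain_lact n b S U : S \in order_complex [set: T] -> U \subset S ->
  ~~ is_chain n (lact b S) -> (#|lact b S| <= n)%N -> ~~ is_chain n (lact b U).
Proof.
move=> SC US nch Sn; apply: contra nch => /andP[_ /eqP Un].
rewrite /is_chain lact_complex //= eqn_leq Sn -{1}Un.
by apply/subset_leq_card/imsetS.
Qed.

End Band.

(** * Separating elements and the equivariant families they generate *)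

Section Separator.
Variables (k : comNzRingType) (B : finLRBType).
Local Notation kB := (monoid_algebra k B).
Local Notation "[@ b ]" := (malg_delta k (b : B)) (format "[@ b ]").
Implicit Types (a : kB) (b c e z : B).

Lemma malg_regular z a : [@z] * a * [@z] = [@z] * a.
Proof.
rewrite [a]malgE big_distrr big_distrl; apply: eq_bigr => b _ /=.
rewrite [malg_const _ _ * _]malg_const_comm !mulrA -mulrA malg_const_comm mulrA.
by rewrite !malg_deltaM lrb_regular.
Qed.

(* The factors do not commute, but they may be multiplied in any order. *)
Definition separator e : kB := [@e] * \prod_(z | (rank z < rank e)%N) (1 - [@z]).

(** [a] gathers the factors already passed; at the factor [1 - [@z]], regularity gives [[@z] * a *
    (1 - [@z]) = 0]. *)
Lemma prod_kill z (r : seq B) (P : pred B) a : z \in r -> P z ->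
  [@z] * a * \prod_(c <- r | P c) (1 - [@c]) = 0.
Proof.
move=> zr Pz; elim: r a zr => // c r IH a; rewrite inE big_cons.
have [<- _|_ /= zr] := eqVneq z c.
  by rewrite Pz mulrA mulrBr mulr1 malg_regular subrr mul0r.
by case: ifP => _; [rewrite mulrA -[_ * a * _]mulrA; exact: IH | exact: IH].
Qed.

(** The element [c * e] has smaller rank than [e], so it indexes one of the factors of the
    product. *)
Lemma separator_kill c e : (e * c)%g != e -> [@c] * separator e = 0.
Proof.
move=> ec; rewrite mulrA malg_deltaM -[[@_]]mulr1; apply: prod_kill.
  by rewrite mem_index_enum.
by rewrite ltnNge; apply: contra ec => /rank_le_fix ->.
Qed.

Lemma delta_separator e : [@e] * separator e = separator e.
Proof. by rewrite mulrA malg_deltaM lrb_idem. Qed.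

Lemma separator_fix (V : lmodType kB) e (v : V) : [@e] *: v = v ->
  (forall z, (rank z < rank e)%N -> [@z] *: v = 0) -> separator e *: v = v.
Proof.
move=> ev zv; rewrite -scalerA (_ : _ *: v = v) //.
elim/big_rec: _ => [|z p zlt pv]; first exact: scale1r.
by rewrite -scalerA pv scalerBl scale1r zv // subr0.
Qed.

Section Spread.
Variables (n : nat) (V : lmodType kB) (e : B) (x : {set lrb_poset B} -> V).
Implicit Type S : {set lrb_poset B}.

(** Turns a family [x], with no compatibility assumed, into an equivariant one that vanishes unless
    [e * top S = e]. *)
Definition spread S : V :=
  if is_chain n.+1 S && is_chain n.+1 (lact e S)
  then [@top S] *: (separator e *: x (lact e S)) else 0.

Lemma spread_kill S : (e * top S)%g != e -> spread S = 0.
Proof.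
by move=> et; rewrite /spread; case: ifP => // _; rewrite scalerA separator_kill ?scale0r.
Qed.

(** If [e * b <> e], both sides vanish because [b * top S] kills [separator e]. If [e * b = e], then
    [S] and [lact b S] have the same image under [e], and only the top is multiplied by [b]. *)
Lemma spread_equivariant : equivariant n.+1 spread.
Proof.
split=> [S /negPf nS | b S Sch]; first by rewrite /spread nS.
have [eb|ebN] := eqVneq (e * b)%g e; last first.
  have [bch|bnch] := boolP (is_chain n.+1 (lact b S)); last first.
    rewrite [RHS]/spread (negPf bnch) /spread; case: ifP => _; last by rewrite scaler0.
    rewrite !scalerA malg_deltaM separator_kill ?scale0r //.
    by apply: contra ebN => /eqP/lrb_fix_mul[->].
  rewrite [RHS]spread_kill; last first.
    by rewrite (top_lact _ Sch); apply: contra ebN => /eqP/lrb_fix_mul[->].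
  rewrite /spread; case: ifP => _; last by rewrite scaler0.
  rewrite !scalerA malg_deltaM separator_kill ?scale0r //.
  by apply: contra ebN => /eqP/lrb_fix_mul[->].
rewrite /spread -lact_mul eb Sch /=.
have [ech|_] := ifP; last by rewrite andbF scaler0.
rewrite (is_chain_lact (b := e) Sch) ?eb //=.
by rewrite (top_lact _ Sch) scalerA malg_deltaM.
Qed.

End Spread.
End Separator.

(** * The chain resolution *)

Section Differential.
Variables (k : comNzRingType) (B : finLRBType).
Local Notation T := (lrb_poset B).
Local Notation kB := (monoid_algebra k B).
Implicit Types (S U : {set T}) (b c : B) (x y : T).

Lemma lact_setD1 b S v : {in S &, injective (fun x : T => (b * (x : B))%g)} ->
  v \in S -> lact b (S :\ v) = lact b S :\ ((b * (v : B))%g : T).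
Proof.
move=> b_inj vS; apply/setP => y; rewrite !inE; apply/imsetP/andP.
  move=> [x]; rewrite !inE => /andP[xv xS] ->; split; last exact: imset_f.
  by apply: contra xv => /eqP/b_inj ->.
move=> [yv /imsetP[x xS yE]]; exists x => //; rewrite !inE xS andbT.
by apply: contra yv => /eqP <-; rewrite yE.
Qed.

Lemma below_lact b S v : {in S &, injective (fun x : T => (b * (x : B))%g)} ->
  S \in order_complex [set: T] -> v \in S ->
  below (lact b S) ((b * (v : B))%g : T) = below S v.
Proof.
move=> b_inj /order_complexP SC vS; rewrite /below.
rewrite -[RHS](card_in_imset (f := fun x : T => (b * (x : B))%g : T)); last first.
  move=> x y; rewrite !inE => /andP[xS _] /andP[yS _]. exact: b_inj.
apply: eq_card => y; rewrite !inE; apply/andP/imsetP.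
  move=> [/imsetP[x xS ->] ltbx]; exists x => //; rewrite !inE xS /=.
  case: (comparable_leP (SC v x vS xS)) => // lexv; move: ltbx.
  by rewrite (le_gtF (lact_mono b lexv)).
move=> [x]; rewrite !inE => /andP[xS ltxv] ->; split; first exact: imset_f.
rewrite lt_neqAle (lact_mono b (ltW ltxv)) andbT.
by apply: contra_ltN ltxv => /eqP/b_inj ->.
Qed.

Lemma below_adjacent S u v : S \in order_complex [set: T] -> u \in S ->
  (u < v)%O -> (forall w, w \in S -> (u < w)%O -> ~~ (w < v)%O) ->
  below S v = (below S u).+1.
Proof.
move=> /order_complexP SC uS ltuv adj; rewrite /below.
rewrite (_ : [set w in S | (w < v)%O] = u |: [set w in S | (w < u)%O]).
  by rewrite cardsU1 !inE ltxx andbF.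
apply/setP => w; rewrite !inE; case: eqP => [->|/eqP wu] /=; first by rewrite uS ltuv.
case wS: (w \in S) => //=; apply/idP/idP => [ltwv|/lt_trans]; last exact.
rewrite lt_neqAle wu /=; case: (comparable_leP (SC w u wS uS)) => // ltuw.
by have := adj w wS ltuw; rewrite ltwv.
Qed.

(* If [b] collapses a chain [S] by exactly one element, then it identifies two
   adjacent vertices, whose two faces have the same image and opposite signs. *)
Lemma cob_equivariant (V : lmodType kB) n (Phi : {set T} -> V) :
  equivariant n Phi ->
  equivariant n.+1 (fun S => if is_chain n.+1 S then cob Phi S else 0).
Proof.
move=> [Phi0 PhiE]; split=> [S /negPf -> // | b S Sch]; rewrite Sch.
have /andP[SC /eqP Sn] := Sch.
have -> : malg_delta k b *: cob Phi S = \sum_(v in S) Phi (lact b (S :\ v)) *~ (-1) ^+ below S v.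
  rewrite scaler_sumr; apply: eq_bigr => v vS; rewrite -PhiE ?is_chainS //.
  by rewrite scalerMzr.
have card_D1 v : v \in S -> #|S :\ v| = n.
  by move=> vS; have := cardsD1 v S; rewrite vS Sn add1n => -[].
have injP v : v \in S -> #|lact b (S :\ v)| = n ->
    {in S :\ v &, injective (fun x : T => (b * (x : B))%g)}.
  by move=> vS vn; apply/imset_injP; rewrite card_D1 //; apply/eqP.
have [bS_card|bS_card] := eqVneq #|lact b S| n.+1.
  have b_inj : {in S &, injective (fun x : T => (b * (x : B))%g)}.
    by apply/imset_injP; rewrite Sn; apply/eqP.
  rewrite /is_chain lact_complex // bS_card eqxx /cob (big_imset _ b_inj) /=.
  by apply: eq_bigr => v vS; rewrite lact_setD1 // below_lact.
have bS_le : (#|lact b S| <= n)%N.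
  by rewrite -ltnS ltn_neqAle bS_card -Sn leq_imset_card.
rewrite {1}/is_chain (negPf bS_card) andbF.
have [/andP[_ /eqP bS_n]|bSch] := boolP (is_chain n (lact b S)); last first.
  apply: big1 => v vS; rewrite Phi0 ?mul0rz //.
  exact: (not_chain_lact SC (subsetDl _ _)).
have [u [v [uS vS ltuv buv]]] : exists u v, [/\ u \in S, v \in S, (u < v)%O &
    (b * (u : B) = b * (v : B))%g].
  have : ~~ dinjectiveb (fun x : T => (b * (x : B))%g) (mem S).
    apply/negP => /dinjectiveP/imset_injP; rewrite Sn => /eqP bSn.
    by have := eqxx n.+1; rewrite -{1}bSn (negPf bS_card).
  case/dinjectivePn => u uS [v]; rewrite inE => /andP[vu vS] buv.
  have /orP[leuv|levu] := order_complexP _ SC u v uS vS.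
    by exists u, v; split; rewrite // lt_neqAle eq_sym vu.
  by exists v, u; split; rewrite // lt_neqAle vu.
have vu : v != u by rewrite gt_eqF.
have imD1 w w' : w \in S -> w' \in S -> w' != w -> (b * (w : B) = b * (w' : B))%g ->
    lact b (S :\ w) = lact b S.
  move=> wS w'S ww' bw; rewrite -[S in RHS](setD1K wS) /lact imsetU1.
  by apply/esym/setUidPr; rewrite sub1set bw; apply: imset_f; rewrite !inE ww'.
have bu := imD1 u v uS vS vu buv.
have bv : lact b (S :\ v) = lact b S by apply: (imD1 v u) => //; rewrite eq_sym.
have Su_inj : {in S :\ u &, injective (fun x : T => (b * (x : B))%g)}.
  by apply: injP; rewrite ?bu.
rewrite (bigD1 u) //= (bigD1 v) ?vS //= big1 ?addr0; last first.
  (* A face containing both [u] and [v] is itself shortened by [b], so it contributes zero. *)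
  move=> w /andP[/andP[wS wu] wv]; rewrite Phi0 ?mul0rz //.
  apply/negP => /andP[_ /eqP wn]; have := injP w wS wn u v.
  by rewrite !inE uS vS ![_ == w]eq_sym wu wv => /(_ isT isT buv)/eqP; rewrite eq_sym (negPf vu).
(* An element [w] strictly between [u] and [v] would be identified with [v] by monotonicity, against
   injectivity on [S :\ u]. *)
rewrite bu bv (below_adjacent SC uS ltuv) ?exprS ?mulN1r ?mulrNz ?subrr // => w wS ltuw.
apply/negP => ltwv; have := Su_inj w v; rewrite !inE wS vS vu gt_eqF //=.
suff bwv : (b * (w : B) = b * (v : B))%g by move=> /(_ isT isT bwv)/eqP; rewrite lt_eqF.
apply: (@le_anti _ T); rewrite (lact_mono b (ltW ltwv)) /= -buv.
exact: lact_mono (ltW ltuw).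
Qed.

Section Complex.
Variable n : nat.
Local Notation K := (chain_module k B).

Lemma chain_basis_equivariant : equivariant n (@chain_basis k B n).
Proof. by split=> [S|b S]; [exact: chain_basis0 | exact: scale_delta_chain]. Qed.

Definition face_sum S : K n :=
  if is_chain n.+1 S then cob (@chain_basis k B n) S else 0.

Definition differential : K n.+1 -> K n := linear_extension face_sum.

HB.instance Definition _ := GRing.Additive.on differential.
HB.instance Definition _ := GRing.isScalable.Build kB (K n.+1) (K n) *:%R differential
  (equivariant_scalable (cob_equivariant chain_basis_equivariant)).

Lemma differential_basis S : is_chain n.+1 S ->
  differential (chain_basis k n.+1 S) = cob (@chain_basis k B n) S.
Proof. by move=> Sch; rewrite /differential linear_extension_basis // /face_sum Sch. Qed.

Lemma linear_differential (V : lmodType kB) (F : {linear K n -> V}) S : is_chain n.+1 S ->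
  F (differential (chain_basis k n.+1 S)) = cob (F \o @chain_basis k B n) S.
Proof. by move=> Sch; rewrite differential_basis // raddf_cob. Qed.

End Complex.
End Differential.

(** * Exactness of the augmented chain complex *)

Section Exactness.
Variables (k : comNzRingType) (B : finLRBType).
Local Notation T := (lrb_poset B).
Local Notation kB := (monoid_algebra k B).
Local Notation K := (chain_module k B).
Local Notation bs n := (@chain_basis k B n).
Local Notation apex := ((1%g : B) : T).
Implicit Types (S U : {set T}) (b c : B) (x y : T).

(** The differential is the transpose of the coboundary matrix, so its square vanishes by
    [incidenceK]. *)
Lemma face_sum_chain n (s : chain [set: T] n.+1) (u : chain [set: T] n) :
  face_sum k n (val s) u = incidence k s u.
Proof.
rewrite /face_sum (valP s : is_chain _ _) sum_ffunE incidenceE.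
apply: eq_bigr => v vs.
by rewrite ffunMzE ffunE eq_sym -mulrzl intr_sign.
Qed.

Lemma differentialE n (f : K n.+1) : differential f = [ffun u => \sum_s incidence k s u * f s].
Proof.
apply/ffunP => u; rewrite ffunE sum_ffunE; apply: eq_bigr => s _.
by rewrite scale_const_chain face_sum_chain mulrC.
Qed.

Lemma differentialK n (f : K n.+2) : differential (differential f) = 0.
Proof.
rewrite !differentialE; apply/ffunP => u; rewrite ffunE [RHS]ffunE.
under eq_bigr do rewrite ffunE big_distrr.
rewrite exchange_big big1 // => s _ /=.
under eq_bigr do rewrite mulrA [incidence _ _ _ * _]mulrC.
by rewrite -big_distrl /= incidenceK mul0r.
Qed.

Lemma le_apex x : (x <= apex)%O.
Proof. by rewrite lrb_leE mul1g. Qed.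

Lemma is_chain_apex n S : is_chain n S -> apex \notin S -> is_chain n.+1 (apex |: S).
Proof.
move=> /andP[/order_complexP SC /eqP Sn] aS.
rewrite /is_chain cardsU1 aS Sn eqxx andbT; apply/order_complexP.
move=> x y; rewrite !inE => /predU1P[->|xS] /predU1P[->|yS]; last exact: SC.
- by rewrite comparablexx.
- by rewrite ge_comparable // le_apex.
- by rewrite le_comparable // le_apex.
Qed.

(* The identity of [B] is the maximum of the poset, hence a cone point. *)
Definition cone_vertex n S : K n.+1 :=
  if apex \in S then 0 else bs n.+1 (apex |: S) *~ (-1) ^+ n.

Definition cone n : K n -> K n.+1 := linear_extension (@cone_vertex n).
HB.instance Definition _ n := GRing.Additive.on (@cone n).

Lemma mulrz_signK (V : zmodType) (v : V) n : v *~ (-1) ^+ n *~ (-1) ^+ n = v.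
Proof. by rewrite -mulrzA -exprD addnn -mul2n exprM sqrrN !expr1n. Qed.

(** If the apex is in [S], the first term is zero and only the face omitting the apex has a nonzero
    cone, which is [S] up to sign. Otherwise [cob_cone] gives [S] plus the cones over its faces,
    cancelling the second term. The sign in [cone_vertex] is that of the face opposite to the
    apex. *)
Lemma coneK_basis n S : is_chain n.+1 S ->
  differential (cone (bs n.+1 S)) + cone (differential (bs n.+1 S)) = bs n.+1 S.
Proof.
move=> Sch; rewrite {1}/cone linear_extension_basis // differential_basis //.
have Sn := is_chain_card Sch.
have coneE v : v \in S -> cone (bs n (S :\ v)) = @cone_vertex n (S :\ v).
  by move=> vS; rewrite /cone linear_extension_basis // is_chainS.
have -> : cone (cob (bs n) S) = cob (@cone_vertex n) S.
  rewrite (raddf_cob (@cone n)); apply: eq_bigr => v vS.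
  by rewrite /= coneE.
have ltS x : x \in S -> x != apex -> (x < apex)%O by move=> _ xa; rewrite lt_neqAle xa le_apex.
have [aS|aS] := boolP (apex \in S).
  rewrite {1}/cone_vertex aS raddf0 add0r /cob (bigD1 apex) //= big1 ?addr0.
    rewrite /cone_vertex !inE eqxx /= setD1K // (_ : below S _ = n) ?mulrz_signK //.
    have := cardsD1 apex S; rewrite aS Sn add1n => -[->]; apply: eq_card => w.
    by rewrite !inE lt_neqAle le_apex andbT andbC.
  by move=> v /andP[vS va]; rewrite /cone_vertex !inE aS eq_sym va mul0rz.
rewrite {1}/cone_vertex (negPf aS) raddfMz /= differential_basis ?is_chain_apex //.
rewrite cob_cone; last first.
  by move=> v vS; apply: ltS => //; apply: contraNneq aS => <-.
rewrite Sn mulrzDl mulrz_signK -addrA; apply/eqP; rewrite addrC -subr_eq0 addrK; apply/eqP.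
rewrite /cob mulrz_suml -big_split big1 // => v vS /=.
rewrite /cone_vertex !inE (negPf aS) andbF -!mulrzA -mulrzDr.
by rewrite exprS mulN1r mulrN [X in - X]mulrC addNr mulr0z.
Qed.

(** [cone] is additive and commutes with constants, but is not claimed to be [kB]-linear; the
    expansion on basis chains is done by hand. *)
Lemma coneK n (f : K n.+1) : differential (cone f) + cone (differential f) = f.
Proof.
pose c s := malg_const B (f s); pose e (s : chain [set: T] n.+1) := bs n.+1 (val s).
have -> : differential (cone f) = \sum_s c s *: differential (cone (e s)).
  rewrite {1}(chain_moduleE f) (raddf_sum (@cone n.+1)).
  rewrite (raddf_sum (@differential k B n.+1)); apply: eq_bigr => s _ /=.
  by rewrite /cone linear_extension_const linearZ.
have -> : cone (differential f) = \sum_s c s *: cone (differential (e s)).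
  rewrite {1}(chain_moduleE f) (raddf_sum (@differential k B n)).
  rewrite (raddf_sum (@cone n)); apply: eq_bigr => s _ /=.
  by rewrite linearZ /cone linear_extension_const.
rewrite [RHS]chain_moduleE -big_split; apply: eq_bigr => s _.
rewrite /= -scalerDr /c /e; congr (_ *: _).
exact/coneK_basis/valP.
Qed.

Lemma differential_exact n (f : K n.+1) :
  differential f = 0 <-> exists g, f = differential g.
Proof.
split=> [f0 | [g ->]]; last exact: differentialK.
by exists (cone f); rewrite -[LHS]coneK f0 raddf0 addr0.
Qed.

End Exactness.

(** * The augmentation onto the trivial module *)

Section Augmentation.
Variables (k : comNzRingType) (B : finLRBType).
Local Notation T := (lrb_poset B).
Local Notation kB := (monoid_algebra k B).
Local Notation K := (chain_module k B).
Local Notation bs n := (@chain_basis k B n).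
Local Notation M := (trivial_module k B).
Local Notation apex := ((1%g : B) : T).
Implicit Types (S U : {set T}) (b c : B) (x y : T).

Lemma is_chain_set1 x : is_chain 1 [set x].
Proof.
rewrite /is_chain cards1 eqxx andbT; apply/order_complexP => u v.
by rewrite !inE => /eqP-> /eqP->; rewrite comparablexx.
Qed.

Lemma is_chain1P S : is_chain 1 S -> exists x, S = [set x].
Proof. by case/andP => _ /cards1P. Qed.

Lemma is_chain_set0 : is_chain 0 (set0 : {set T}).
Proof.
by rewrite /is_chain cards0 eqxx andbT; apply/order_complexP => x y; rewrite inE.
Qed.

Definition vertex_unit S : M := ((is_chain 1 S)%:R : k).

Lemma vertex_unit_equivariant : @equivariant k B 1 M vertex_unit.
Proof.
split=> [S /negPf nS | b S Sch]; first by rewrite /vertex_unit nS.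
have [x Sx] := is_chain1P Sch.
rewrite /vertex_unit Sch Sx /lact imset_set1 is_chain_set1.
by rewrite /GRing.scale /= /trivial_scale augmentation_delta mulr1.
Qed.

Definition vertex_augmentation : K 1 -> M := linear_extension vertex_unit.
HB.instance Definition _ := GRing.Additive.on vertex_augmentation.
HB.instance Definition _ := GRing.isScalable.Build kB (K 1) M *:%R vertex_augmentation
  (equivariant_scalable vertex_unit_equivariant).

Lemma vertex_augmentationE (f : K 1) : vertex_augmentation f = \sum_s f s :> k.
Proof.
apply: eq_bigr => s _; rewrite /GRing.scale /= /trivial_scale augmentation_const.
by rewrite /vertex_unit (valP s : is_chain _ _) mulr1.
Qed.

(** [K 0] is spanned by the empty chain, so the last differential is the augmentation in disguise,
    and exactness at [K 1] reduces to [differential_exact]. *)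
Lemma differential0E (f : K 1) : differential f = [ffun => vertex_augmentation f].
Proof.
rewrite differentialE; apply/ffunP => u; rewrite !ffunE vertex_augmentationE.
apply: eq_bigr => s _; rewrite -[RHS]mul1r; congr (_ * _).
have [x sx] := is_chain1P (valP s : is_chain _ _).
have u0 : val u = set0 by apply: cards0_eq; exact: is_chain_card (valP u : is_chain _ _).
rewrite incidenceE u0 sx big_set1 setDv eqxx mulr1 (_ : below _ x = 0%N) //.
by apply: eq_card0 => w; rewrite !inE; case: eqP => // ->; rewrite ltxx.
Qed.

Lemma vertex_augmentation_exact (f : K 1) :
  vertex_augmentation f = 0 <-> exists g : K 2, f = differential g.
Proof.
rewrite -differential_exact differential0E; split=> [-> | /ffunP].
  by apply/ffunP => u; rewrite !ffunE.
by move=> /(_ (Chain is_chain_set0)); rewrite !ffunE.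
Qed.

Lemma vertex_augmentation_surj (m : M) : exists f, vertex_augmentation f = m.
Proof.
exists (malg_const B (m : k) *: bs 1 [set apex]).
rewrite linearZ /= /vertex_augmentation linear_extension_basis ?is_chain_set1 //.
rewrite /vertex_unit is_chain_set1 /GRing.scale /= /trivial_scale.
by rewrite augmentation_const mulr1.
Qed.

End Augmentation.

(** * Corrections rank by rank and projectivity *)

Section Layers.
Variables (k : comNzRingType) (B : finLRBType).
Variables (e : {set B} -> B) (he : forall Y, Y \in Lambda B -> left_ideal (e Y) = Y).
Local Notation T := (lrb_poset B).
Local Notation kB := (monoid_algebra k B).
Local Notation K := (chain_module k B).
Local Notation bs n := (@chain_basis k B n).
Local Notation "[@ b ]" := (malg_delta k (b : B)) (format "[@ b ]").
Implicit Types (S U : {set T}) (b c z t : B) (x y : T) (Y : {set B}).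

Lemma left_ideal_Lambda b : left_ideal b \in Lambda B.
Proof. exact: imset_f. Qed.

Lemma rank_rep Y : Y \in Lambda B -> rank (e Y) = #|Y|.
Proof. by move=> /he YE; rewrite /rank YE. Qed.

(** [t] and its representative generate the same left ideal, so each absorbs the other on the
    right. *)
Lemma rep_mulr t : (e (left_ideal t) * t = e (left_ideal t))%g.
Proof.
by have := left_ideal_id (e (left_ideal t)); rewrite he ?left_ideal_Lambda // => /left_idealP.
Qed.

Lemma mul_rep t : (t * e (left_ideal t) = t)%g.
Proof.
by apply/left_idealP; rewrite (he (left_ideal_Lambda t)) left_ideal_id.
Qed.

Section Layer.
Variables (n c : nat) (V : lmodType kB) (x : {set B} -> {set T} -> V).

(** The correction made at rank [c]: it leaves the values at smaller ranks untouched. *)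
Definition layer S : V := \sum_(Y in Lambda B | #|Y| == c) spread n (e Y) (x Y) S.

Lemma layer_equivariant : equivariant n.+1 layer.
Proof.
split=> [S nS | b S Sch].
  by apply: big1 => Y _; case: (spread_equivariant n (e Y) (x Y)) => ->.
rewrite scaler_sumr; apply: eq_bigr => Y _.
by case: (spread_equivariant n (e Y) (x Y)) => _ ->.
Qed.

Lemma layer_low S : (rank (top S) < c)%N -> layer S = 0.
Proof.
move=> lt_c; apply: big1 => Y /andP[YL /eqP Yc]; apply: spread_kill.
apply: contraTneq lt_c => eS; rewrite -leqNgt -Yc -(rank_rep YL).
exact/subset_leq_card/left_idealS.
Qed.

(** For [Y] of cardinality [c], [e Y * top S = e Y] forces [Y] to be the left ideal of [top S], so
    one term survives. *)
Lemma layer_top S : rank (top S) = c ->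
  layer S = spread n (e (left_ideal (top S))) (x (left_ideal (top S))) S.
Proof.
move=> Sc; rewrite /layer (bigD1 (left_ideal (top S))) /=; last first.
  by rewrite left_ideal_Lambda -Sc eqxx.
rewrite big1 ?addr0 // => Y /andP[/andP[YL /eqP Yc] YS]; apply: spread_kill.
apply: contraNneq YS => eS; apply/eqP/esym.
by rewrite (left_ideal_eq eS) ?he // (rank_rep YL) Yc Sc.
Qed.

End Layer.

Section VanishingBelow.
Variables (n c : nat) (V : lmodType kB) (F : {linear K n.+1 -> V}).

Lemma linear_lact b S : is_chain n.+1 S -> F (bs n.+1 (lact b S)) = [@b] *: F (bs n.+1 S).
Proof. by move=> Sch; rewrite -linearZ /= scale_delta_chain. Qed.

Lemma is_chain_rep S : is_chain n.+1 S ->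
  is_chain n.+1 (lact (e (left_ideal (top S))) S).
Proof.
by move=> Sch; apply: (is_chain_lact (b := top S) Sch); rewrite mul_rep (lact_top Sch).
Qed.

(** As [top S] fixes [S] and absorbs its representative, [S] is a translate of a chain whose top is
    the representative. *)
Lemma linear_rep S : is_chain n.+1 S ->
  F (bs n.+1 S) = [@top S] *: F (bs n.+1 (lact (e (left_ideal (top S))) S)).
Proof.
move=> Sch; rewrite -linear_lact ?is_chain_rep // -lact_mul mul_rep.
by rewrite (lact_top Sch).
Qed.

Variable F0 : forall S, is_chain n.+1 S -> (rank (top S) < c)%N -> F (bs n.+1 S) = 0.

(** An element of rank below that of [z] either shortens [S] or lowers the rank of its top below
    [c], so it kills the value and [separator_fix] applies. *)
Lemma separator_linear z S : is_chain n.+1 S -> (rank z <= c)%N ->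
  lact z S = S -> separator k z *: F (bs n.+1 S) = F (bs n.+1 S).
Proof.
move=> Sch zc zS; apply: separator_fix => [|b bz]; rewrite -linear_lact ?zS //.
have [bch|bch] := boolP (is_chain n.+1 (lact b S)); last first.
  by rewrite chain_basis0 ?linear0.
apply: F0 => //; rewrite (top_lact _ Sch).
exact: leq_ltn_trans (rank_mulr _ _) (leq_trans bz zc).
Qed.

End VanishingBelow.

Lemma lact_idem b S : lact b (lact b S) = lact b S.
Proof. by rewrite -lact_mul lrb_idem. Qed.

Lemma chain_module_projective n : projective (K n.+1).
Proof.
move=> M N g f g_surj.
suff [h hE] : exists h : {linear K n.+1 -> M}, forall S, is_chain n.+1 S ->
    (rank (top S) < #|B|.+1)%N -> g (h (bs n.+1 S)) = f (bs n.+1 S).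
  exists h; apply: (@eq_on_basis _ _ _ _ (g \o h) f) => S Sch; apply: hE => //.
  by rewrite ltnS max_card.
elim: #|B|.+1 => [|c [h hE]]; first by exists \0.
(* [F] is the error of the current lift. Its preimages [x] are chosen freely, and [layer] makes them
   equivariant. *)
pose F : {linear K n.+1 -> N} := f \- (g \o h).
have F0 S : is_chain n.+1 S -> (rank (top S) < c)%N -> F (bs n.+1 S) = 0.
  by move=> Sch Sc; rewrite /F /= hE ?subrr.
have /fin_all_exists[x xE] : forall U, exists m : M, g m = F (bs n.+1 U).
  by move=> U; exact: g_surj.
have [h' h'E] := equivariant_extension (layer_equivariant n c (fun=> x)).
exists (h \+ h') => S Sch Sc; rewrite /= linearD /= h'E linear_extension_basis //.
suff -> : g (layer n c (fun=> x) S) = F (bs n.+1 S) by rewrite /F /= addrC subrK.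
have [ltc|gec] := ltnP (rank (top S)) c; first by rewrite layer_low // linear0 F0.
have {gec}Sc : rank (top S) = c by apply/eqP; rewrite eqn_leq gec andbT -ltnS.
(* The separator carried by [layer] fixes the values of [F] here, so the correction maps onto the
   error. *)
rewrite layer_top // /spread Sch is_chain_rep //= !linearZ /= xE.
rewrite (separator_linear F0) ?is_chain_rep ?lact_idem -?linear_rep //.
by rewrite rank_rep ?left_ideal_Lambda // -Sc.
Qed.

(** Degree [m] has the chains with [m.+1] elements, the simplices of dimension [m]; every one of
    them has a maximum, as the rank induction requires. *)
Definition chain_resolution : projective_resolution (trivial_module k B) :=
  @ProjectiveResolution _ (trivial_module k B) (fun m => K m.+1)
    (fun m => @differential k B m.+1) (@vertex_augmentation k B)
    chain_module_projective (@vertex_augmentation_surj k B)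
    (@vertex_augmentation_exact k B) (fun m => @differential_exact k B m.+1).

End Layers.

(** * Boundaries and cohomological dimension *)

Section Boundary.
Variables (B : finLRBType) (e : B).
Local Notation T := (lrb_poset B).
Implicit Types (S U : {set T}) (x y v : T).

Lemma boundaryP x : reflect (x < (e : T))%O (x \in boundary e).
Proof.
rewrite in_setD1 lt_neqAle lrb_leE; apply: (iffP andP) => [[xe /imsetP[y _ xE]]|].
  by rewrite xe xE mulgA lrb_idem eqxx.
by case/andP=> xe /eqP xE; split=> //; apply/imsetP; exists x.
Qed.

Variable m : nat.
Definition boundary_chain S := (S \in order_complex (boundary e)) && (#|S| == m).
Variables (S : {set T}) (Sch : boundary_chain S).

Lemma boundary_chain_lt v : v \in S -> (v < (e : T))%O.
Proof.
case/andP: Sch; rewrite inE => /andP[/subsetP Sb _] _ vS.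
exact/boundaryP/Sb.
Qed.

Lemma boundary_chain_notin : (e : T) \notin S.
Proof. by apply/negP => /boundary_chain_lt; rewrite ltxx. Qed.

Lemma boundary_chain_chain : is_chain m S.
Proof. by case/andP: Sch; rewrite /is_chain !inE subsetT => /andP[_ ->]. Qed.

Lemma cone_chain : is_chain m.+1 ((e : T) |: S).
Proof.
have /andP[/order_complexP SC /eqP Sm] := boundary_chain_chain.
rewrite /is_chain cardsU1 boundary_chain_notin Sm eqxx andbT.
apply/order_complexP => x y; rewrite !inE => /predU1P[->|xS] /predU1P[->|yS].
- by rewrite comparablexx.
- by rewrite ge_comparable // ltW // boundary_chain_lt.
- by rewrite le_comparable // ltW // boundary_chain_lt.
- exact: SC.
Qed.

Lemma cone_top : top ((e : T) |: S) = e.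
Proof.
apply: top_unique => [|x]; first by rewrite setU11.
by rewrite !inE => /predU1P[-> //|/boundary_chain_lt/ltW].
Qed.

Lemma cone_lact : lact e ((e : T) |: S) = (e : T) |: S.
Proof. by have := lact_top cone_chain; rewrite cone_top. Qed.

Lemma cone_D1 : ((e : T) |: S) :\ (e : T) = S.
Proof. by rewrite setU1K // boundary_chain_notin. Qed.

End Boundary.

Section BoundaryTop.
Variables (B : finLRBType) (e : B) (m : nat).
Local Notation T := (lrb_poset B).
Implicit Type S : {set T}.

Lemma boundary_chain_top S : boundary_chain e m.+1 S -> (e * top S)%g != e.
Proof.
move=> Sch; have [tS _] := top_max (boundary_chain_chain Sch).
have := boundary_chain_lt Sch tS; rewrite lt_neqAle => /andP[tne].
by rewrite lrb_leE => /eqP ->.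
Qed.

(** For [t < e] one has [t * e = e * t * e = e * t = t]; were the rank of [t] at least that of [e],
    [rank_le_fix] would give [e * t = e]. *)
Lemma boundary_chain_rank S : boundary_chain e m.+1 S -> (rank (top S) < rank e)%N.
Proof.
move=> Sch; have [tS _] := top_max (boundary_chain_chain Sch).
have /eqP et := ltW (boundary_chain_lt Sch tS).
rewrite ltnNge; apply: contra (boundary_chain_top Sch) => le_e.
by apply/eqP/rank_le_fix; rewrite -[X in rank (X * _)%g]et lrb_regular et.
Qed.

Lemma boundary_chainS S v : boundary_chain e m.+1 S -> v \in S ->
  boundary_chain e m (S :\ v).
Proof. by move=> Sch vS; exact: (@chain_facet _ _ (boundary e) m (exist _ S Sch)). Qed.

(** Inverse of coning: chains with top [e] correspond to chains of the boundary with one element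
    less. *)
Lemma uncone S : is_chain m.+1 S -> top S = e ->
  boundary_chain e m (S :\ (e : T)) /\ (e : T) |: (S :\ (e : T)) = S.
Proof.
move=> Sch Se; have [] := top_max Sch; rewrite Se => eS emax; split; last exact: setD1K.
have /andP[/order_complexP SC /eqP Sm] := Sch.
have := cardsD1 (e : T) S; rewrite /boundary_chain eS Sm add1n => -[<-].
rewrite eqxx andbT inE; apply/andP; split.
  apply/subsetP => x; rewrite in_setD1 => /andP[xe xS]; apply/boundaryP.
  by rewrite lt_neqAle xe emax.
apply/forall_inP => x; rewrite !inE => /andP[_ xS].
by apply/forall_inP => y; rewrite !inE => /andP[_ yS]; exact: SC.
Qed.

End BoundaryTop.

Lemma coboundary_cob (d : Order.disp_t) (T : finPOrderType d) (A : {set T})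
    (k : comNzRingType) n (f : cochain A k n) (Phi : {set T} -> k) (s : chain A n.+1) :
  (forall t : chain A n, Phi (val t) = f t) -> coboundary f s = cob Phi (val s).
Proof.
move=> Phif; rewrite ffunE; apply: eq_bigr => v vs.
by rewrite (insub_facet vs) /= -Phif -mulrzl intr_sign.
Qed.

(** * A rank one module attached to an element of the band *)

Section CharacterModule.
Variables (k : comNzRingType) (B : finLRBType) (e : B).
Local Notation kB := (monoid_algebra k B).

(** The parameter selects which action the instance below puts on [k]. *)
Definition character_module (b : B) : Type := k.
Local Notation V := (character_module e).

HB.instance Definition _ b := GRing.Zmodule.copy (character_module b) k.

Definition character_scale (f : kB) (x : V) : V :=
  ((\sum_b f b * ((e * b)%g == e)%:R) * x : k).

(** By [lrb_fix_mul], the indicator of [e * b = e] is multiplicative in [b]. *)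
Lemma character_scaleA f g x :
  character_scale f (character_scale g x) = character_scale (f * g) x.
Proof.
rewrite /character_scale mulrA; congr (_ * _).
rewrite (@sum_malg_mul k B f g) big_distrlr.
apply: eq_bigr => b _; apply: eq_bigr => c _; rewrite /= mulrACA -natrM mulnb.
congr (_ * _%:R); congr (nat_of_bool _); apply/andP/eqP.
  by rewrite mulgA => -[/eqP-> /eqP->].
by move=> /lrb_fix_mul[-> ->].
Qed.

Lemma character_scale1 : left_id 1 character_scale.
Proof.
move=> x; rewrite /character_scale (bigD1 1%g) //= ffunE eqxx mulg1 eqxx mulr1.
by rewrite big1 ?addr0 ?mul1r // => b /negPf b1; rewrite ffunE b1 mul0r.
Qed.

Lemma character_scaleDr : right_distributive character_scale +%R.
Proof. by move=> f x y; rewrite /character_scale -mulrDr. Qed.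

Lemma character_scaleDl x : {morph character_scale^~ x : f g / f + g}.
Proof.
move=> f g; rewrite /character_scale -mulrDl; congr (_ * _).
by rewrite -big_split; apply: eq_bigr => b _; rewrite ffunE mulrDl.
Qed.

HB.instance Definition _ := GRing.Zmodule_isLmodule.Build kB V
  character_scaleA character_scale1 character_scaleDr character_scaleDl.

Lemma character_delta b (x : V) :
  malg_delta k b *: x = if (e * b)%g == e then x else 0.
Proof.
rewrite [LHS]/GRing.scale /= /character_scale (bigD1 b) //= ffunE eqxx mul1r.
rewrite big1 ?addr0 => [|c /negPf cb]; last by rewrite ffunE cb mul0r.
by case: eqP; rewrite ?mul1r ?mul0r.
Qed.

Lemma character_separator (x : V) : separator k e *: x = x.
Proof.
apply: separator_fix => [|z zlt]; rewrite character_delta ?lrb_idem ?eqxx //.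
case: eqP => // ez; move: zlt; rewrite ltnNge.
by rewrite (subset_leq_card (left_idealS ez)).
Qed.

End CharacterModule.

(** * Upper and lower bounds for the cohomological dimension *)

Section CohomologicalDimension.
Variables (k : comNzRingType) (B : finLRBType).
Variables (e : {set B} -> B) (he : forall Y, Y \in Lambda B -> left_ideal (e Y) = Y).
Local Notation T := (lrb_poset B).
Local Notation kB := (monoid_algebra k B).
Local Notation K := (chain_module k B).
Local Notation bs n := (@chain_basis k B n).
Local Notation "[@ b ]" := (malg_delta k (b : B)) (format "[@ b ]").
Implicit Types (S U : {set T}) (b c z t : B) (x y : T) (Y : {set B}).

(* The face of the cone opposite to its apex contributes nothing when [F]
   vanishes on it, so [F] restricts to a cochain of the boundary. *)
Lemma linear_differential_cone n (V : lmodType kB) (F : {linear K n.+1 -> V}) b S :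
  boundary_chain b n.+1 S -> F (bs n.+1 S) = 0 ->
  F (differential (bs n.+2 ((b : T) |: S))) =
    cob (fun U => F (bs n.+1 ((b : T) |: U))) S.
Proof.
move=> Sch FS; rewrite linear_differential ?(cone_chain Sch) // cob_cone /=.
  by rewrite FS mul0rz add0r.
exact: boundary_chain_lt Sch.
Qed.

Lemma rank_top_D1 n S v : is_chain n.+2 S -> v \in S ->
  (rank (top (S :\ v)) <= rank (top S))%N.
Proof.
move=> Sch vS; have [tS _] := top_max (is_chainS Sch vS).
have [_ Smax] := top_max Sch; move: tS; rewrite in_setD1 => /andP[_ /Smax].
by rewrite lrb_leE => /eqP <-; exact: rank_mulr.
Qed.

(** On the boundary of [e Y], [U |-> F (e Y |: U)] is a cocycle: [F] kills boundaries, and also the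
    base of each cone, whose top has rank below [c]. Acyclicity with coefficients supplies
    [theta Y]. *)
Lemma boundary_cochain_extends n j (c : nat) (V : lmodType kB) (F : {linear K j.+2 -> V}) :
    (forall Y, Y \in Lambda B -> forall m, (n < m)%N ->
       ~ reduced_cohomology_neq0 (boundary (e Y)) k m) -> (n <= j)%N ->
    (forall f, F (differential f) = 0) ->
    (forall S, is_chain j.+2 S -> (rank (top S) < c)%N -> F (bs j.+2 S) = 0) ->
  exists theta : {set B} -> {set T} -> V, forall Y S,
    Y \in Lambda B -> #|Y| = c -> boundary_chain (e Y) j.+1 S ->
    cob (theta Y) S = F (bs j.+2 ((e Y : T) |: S)).
Proof.
move=> acyclic nj Fd F0; suff /fin_all_exists[theta thetaE] : forall Y, exists th : {set T} -> V,
    forall S, Y \in Lambda B -> #|Y| = c -> boundary_chain (e Y) j.+1 S ->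
      cob th S = F (bs j.+2 ((e Y : T) |: S)).
  by exists theta.
move=> Y; have [/andP[YL /eqP Yc]|YN] := boolP ((Y \in Lambda B) && (#|Y| == c)); last first.
  by exists (fun=> 0) => S YL Yc; case/negP: YN; rewrite YL Yc eqxx.
have [u|th thE] := acyclic_coefficients (@malg_const k B) (acyclic Y YL)
    (Phi := fun U => F (bs j.+2 ((e Y : T) |: U))) nj.
  have uch : boundary_chain (e Y) j.+2 (val u) by exact: valP.
  rewrite -linear_differential_cone ?Fd // F0 ?(boundary_chain_chain uch) //.
  by rewrite -Yc -(rank_rep he YL); exact: boundary_chain_rank uch.
by exists th => S _ _ Sch; exact: (thE (exist _ S Sch)).
Qed.

Lemma chain_resolution_vanishing n j (V : lmodType kB) (F : {linear K j.+2 -> V}) :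
    (forall Y, Y \in Lambda B -> forall m, (n < m)%N ->
       ~ reduced_cohomology_neq0 (boundary (e Y)) k m) -> (n <= j)%N ->
    (forall f, F (differential f) = 0) ->
  exists G : {linear K j.+1 -> V}, forall f, F f = G (differential f).
Proof.
move=> acyclic nj Fd.
suff [G GE] : exists G : {linear K j.+1 -> V}, forall S, is_chain j.+2 S ->
    (rank (top S) < #|B|.+1)%N -> F (bs j.+2 S) = G (differential (bs j.+2 S)).
  exists G; apply: (@eq_on_basis _ _ _ _ F (G \o @differential k B j.+1)) => S Sch.
  by apply: GE => //; rewrite ltnS max_card.
elim: #|B|.+1 => [|c [G GE]]; first by exists \0.
pose F1 : {linear K j.+2 -> V} := F \- (G \o @differential k B j.+1).
have F10 S : is_chain j.+2 S -> (rank (top S) < c)%N -> F1 (bs j.+2 S) = 0.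
  by move=> Sch Sc; rewrite /F1 /= GE ?subrr.
have F1d f : F1 (differential f) = 0.
  by rewrite /F1 /= Fd differentialK linear0 subrr.
have [theta thetaE] := boundary_cochain_extends acyclic nj F1d F10.
(* [theta Y] lives on the boundary of [e Y]; deleting the apex carries it to chains with top [e Y],
   and [layer] to all chains. *)
pose Gamma := layer e j c (fun Y U => theta Y (U :\ (e Y : T))).
have [G1 G1E] := equivariant_extension (layer_equivariant e j c
  (fun Y U => theta Y (U :\ (e Y : T)))).
have {}G1E S : is_chain j.+1 S -> G1 (bs j.+1 S) = Gamma S.
  by move=> Sch; rewrite G1E linear_extension_basis.
exists (G \+ G1) => S Sch Sc /=.
suff <- : F1 (bs j.+2 S) = G1 (differential (bs j.+2 S)) by rewrite /F1 /= addrC subrK.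
have [ltc|gec] := ltnP (rank (top S)) c.
  (* Both sides vanish, since a face has a top of no larger rank. *)
  rewrite F10 // linear_differential // /cob big1 // => v vS /=.
  rewrite G1E ?is_chainS // /Gamma (layer_low he) ?mul0rz //.
  exact: leq_ltn_trans (rank_top_D1 Sch vS) ltc.
have {gec}Sc' : rank (top S) = c by apply/eqP; rewrite eqn_leq gec andbT -ltnS.
(* It suffices to compare both maps on the translate [U] with top [e Y], which is a cone over a
   chain of the boundary. *)
rewrite (linear_rep he F1 Sch).
rewrite [RHS](linear_rep he (G1 \o @differential k B j.+1) Sch) /=.
congr (_ *: _); set Y := left_ideal (top S); set U := lact _ S.
have YL : Y \in Lambda B by exact: left_ideal_Lambda.
have YE : left_ideal (e Y) = Y by exact: he.
have Uch : is_chain j.+2 U by exact: (is_chain_rep he Sch).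
have Utop : top U = e Y by rewrite (top_lact _ Sch) (rep_mulr he).
have [sch <-] := uncone Uch Utop; move: (U :\ _) sch => S' sch.
have eYc : rank (e Y) = c by rewrite (rank_rep he YL) -Sc'.
rewrite linear_differential_cone //; last first.
  rewrite G1E ?(boundary_chain_chain sch) // /Gamma (layer_low he) // -eYc.
  exact: boundary_chain_rank sch.
(* The values of [layer] carry a separator; it may be inserted on the left because it fixes the
   value of [F1] on the cone. *)
transitivity (separator k (e Y) *: cob (theta Y) S').
  rewrite thetaE // ?(separator_linear F10) ?eYc ?(cone_chain sch) ?(cone_lact sch) //.
rewrite (raddf_cob (GRing.scale (separator k (e Y)))).
apply: eq_cob => v vS'; have sch' := boundary_chainS sch vS'.
rewrite /= G1E ?(cone_chain sch') // /Gamma (layer_top he); last by rewrite (cone_top sch').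
rewrite (cone_top sch') YE /spread (cone_lact sch') (cone_chain sch') /=.
by rewrite (cone_D1 sch') (cone_top sch') scalerA delta_separator.
Qed.

Lemma boundary_cochain_Ext b m :
  reduced_cohomology_neq0 (boundary b) k m ->
  hom_cohomology_neq0 (chain_resolution k he) (character_module k b) m.
Proof.
move=> [alpha [alpha0 alphaN]].
pose V : lmodType kB := character_module k b.
pose al S : V := oapp alpha 0 (insub S).
have alE (s : chain (boundary b) m) : al (val s) = alpha s by rewrite /al valK.
have [F FE] := equivariant_extension
  (spread_equivariant m b (fun U => al (U :\ (b : T)))).
have Fcone S : boundary_chain b m S -> F (bs m.+1 ((b : T) |: S)) = al S.
  move=> Sch; rewrite FE linear_extension_basis ?(cone_chain Sch) // /spread.
  rewrite (cone_lact Sch) (cone_chain Sch) /= (cone_top Sch) (cone_D1 Sch).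
  by rewrite scalerA delta_separator character_separator.
have Fkill S : is_chain m.+1 S -> (b * top S)%g != b -> F (bs m.+1 S) = 0.
  by move=> Sch tS; rewrite FE linear_extension_basis // spread_kill.
exists F; split.
  move=> f; apply: (@eq_on_basis _ _ _ _ (F \o @differential k B m.+1) \0) => S Sch /=.
  (* [top S] fixes [S], but acts as zero on the character module unless [b * top S = b]. *)
  have := linear_lact (F \o @differential k B m.+1) (top S) Sch.
  rewrite (lact_top Sch) character_delta /=; case: eqP => // bt _.
  (* Since [b] acts as the identity, [S] may be replaced by [lact b S], whose top is [b]. *)
  have := linear_lact (F \o @differential k B m.+1) b Sch.
  rewrite character_delta lrb_idem eqxx /= => <-.
  have [Uch|Uch] := boolP (is_chain m.+2 (lact b S)); last first.
    by rewrite chain_basis0 // !linear0.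
  have [|sch <-] := uncone (e := b) Uch; first by rewrite (top_lact _ Sch).
  move: (lact b S :\ _) sch => S' sch.
  rewrite linear_differential_cone //; last first.
    by apply: Fkill; [exact: boundary_chain_chain sch | exact: boundary_chain_top sch].
  transitivity (cob al S').
    by apply: eq_cob => v vS'; rewrite Fcone // boundary_chainS.
  have /ffunP/(_ (exist _ S' sch)) := alpha0.
  by rewrite (coboundary_cob _ alE) [RHS]ffunE.
case: m alpha alpha0 alphaN @al alE F FE Fcone Fkill =>
    [|j] alpha alpha0 alphaN al alE F _ Fcone Fkill.
  move=> F0; apply: alphaN; apply/ffunP => s; rewrite ffunE -alE -Fcone ?F0 //.
  exact: valP.
move=> [G GE]; apply: alphaN.
(* Restricting [G] to cones gives a primitive of [alpha]. *)
exists [ffun s => G (bs j.+1 ((b : T) |: val s)) : k]; apply/ffunP => s.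
have sch : boundary_chain b j.+1 (val s) by exact: valP.
rewrite (coboundary_cob (Phi := fun U => G (bs j.+1 ((b : T) |: U)) : k)); last first.
  by move=> t; rewrite ffunE.
rewrite -alE -Fcone // GE linear_differential_cone //.
(* The base of the cone contributes zero: its top fixes it, yet acts as zero on the character
   module. *)
have := linear_lact G (top (val s)) (boundary_chain_chain sch).
by rewrite (lact_top (boundary_chain_chain sch)) character_delta (negPf (boundary_chain_top sch)).
Qed.

Lemma reduced_cohomology_bound (A : {set T}) m :
  reduced_cohomology_neq0 A k m -> (m <= #|B|)%N.
Proof.
case=> f [_ fN]; rewrite leqNgt; apply/negP => mB.
have empty (s : chain A m) : False.
  have /andP[_ /eqP sm] := valP s.
  by have := max_card (mem (val s)); rewrite sm leqNgt mB.
case: m f fN mB empty => [|m] f fN mB empty //.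
by apply: fN; exists 0; apply/ffunP => s; case: (empty s).
Qed.

(** For [Y] of least cardinality the boundary is empty, as its elements would generate smaller left
    ideals; its reduced cohomology is [k] in dimension -1. Hence a largest degree exists. *)
Lemma reduced_cohomology_minimal :
  exists2 Y, Y \in Lambda B & reduced_cohomology_neq0 (boundary (e Y)) k 0.
Proof.
have L1 : left_ideal 1%g \in Lambda B by exact: left_ideal_Lambda.
case: (@arg_minnP _ (left_ideal 1%g) (mem (Lambda B)) (fun Y => #|Y|) L1) => Y YL Ymin.
exists Y => //; exists [ffun => 1]; split.
  apply/ffunP => s; have sch : boundary_chain (e Y) 1 (val s) by exact: valP.
  have := boundary_chain_rank sch; rewrite (rank_rep he YL) ltnNge.
  by rewrite (Ymin (left_ideal (top (val s))) (left_ideal_Lambda _)).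
have ch0 : boundary_chain (e Y) 0 set0.
  rewrite /boundary_chain cards0 eqxx andbT inE sub0set /=.
  by apply/forall_inP => x; rewrite inE.
by move/ffunP/(_ (exist _ set0 ch0))/eqP; rewrite !ffunE oner_eq0.
Qed.

End CohomologicalDimension.

Theorem theorem10p1 (k : comNzRingType) (B : finLRBType)
    (e : {set B} -> B)
    (he : forall Y, Y \in Lambda B -> left_ideal (e Y) = Y) :
  exists n : nat,
    is_cohomological_dimension k B n /\
    is_largest (fun m => exists2 Y, Y \in Lambda B &
                  reduced_cohomology_neq0 (boundary (e Y)) k m) n.
Proof.
pose P m := exists2 Y, Y \in Lambda B & reduced_cohomology_neq0 (boundary (e Y)) k m.
have P0 : exists m, `[< P m >].
  by exists 0%N; apply/asboolP; exact: reduced_cohomology_minimal.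
have Pbound m : `[< P m >] -> (m <= #|B|)%N.
  by move=> /asboolP[Y _]; exact: reduced_cohomology_bound.
case: (ex_maxnP P0 Pbound) => n /asboolP[Y YL Yn] nmax.
exists n; split; last first.
  by split=> [|m Pm]; [exists Y | apply: nmax; apply/asboolP].
(* Any upper bound [u] is at least [n], because the character module of [e Y] has nonzero cohomology
   in degree [n]. *)
split=> [[|j] [V [R RV]] // | u umax]; last first.
  apply: umax; exists (character_module k (e Y)), (chain_resolution k he).
  exact: boundary_cochain_Ext.
rewrite ltnNge; apply/negP => nj.
(* The class lives on an arbitrary resolution [R]; moved to the chain resolution, it must vanish
   above degree [n]. *)
have [F [Fd FN]] := hom_cohomology_transfer (chain_resolution k he) RV.
apply: FN; apply: (chain_resolution_vanishing he _ nj) Fd => Z ZL m nm Zm.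
by have := nmax m; rewrite leqNgt nm => /(_ (asboolT (ex_intro2 _ _ Z ZL Zm))).
Qed.
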